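(* Let $\Delta$ be the specific simplicial complex on $\{1,\ldots,15\}$ defined in the context, and let $\mathcal{W}_{\mathrm{shift}}(\Delta)$ be the set of combinatorial shifted complexes of $\Delta$. (a) There is no $\Delta^c_\sharp\in\mathcal{W}_{\mathrm{shift}}(\Delta)$ such that $\beta_{i\,i+j}(I_{\Delta^c})\le\beta_{i\,i+j}(I_{\Delta^c_\sharp})$ for all $\Delta^c\in\mathcal{W}_{\mathrm{shift}}(\Delta)$ and for all $i$ and $j$. (b) There is no $\Delta^c_\flat\in\mathcal{W}_{\mathrm{shift}}(\Delta)$ such that $\beta_{i\,i+j}(I_{\Delta^c_\flat})\le\beta_{i\,i+j}(I_{\Delta^c})$ for all $\Delta^c\in\mathcal{W}_{\mathrm{shift}}(\Delta)$ and for all $i$ and $j$.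
   Context: Let $K$ be a field, $n=15$, $[n]=\{1,\ldots,n\}$, and $S=K[x_1,\ldots,x_n]$ with each $\deg x_i=1$. For a homogeneous ideal $I\subset S$, $\beta_{ij}(I)=\dim_K\mathrm{Tor}^S_i(K,I)_j$. A simplicial complex $\Delta$ on $[n]$ is a collection of subsets of $[n]$ containing all $\{j\}$, $j\in[n]$, and closed under taking subsets. $I_\Delta\subset S$ is the Stanley–Reisner ideal, generated by the $x_\sigma=\prod_{k\in\sigma}x_k$ with $\sigma\notin\Delta$. $\Delta$ is shifted if for each $\sigma\in\Delta$ and $i\in\sigma$ one has $(\sigma\setminus\{i\})\cup\{j\}\in\Delta$ for all $j>i$ with $j\notin\sigma$. For $1\le i<j\le n$, $\mathrm{Shift}_{ij}(\Delta)$ is the simplicial complex whose faces are the sets $C_{ij}(\sigma)$, $\sigma\in\Delta$, where $C_{ij}(\sigma)=(\sigma\setminus\{i\})\cup\{j\}$ if $i\in\sigma$, $j\notin\sigma$ and $(\sigma\setminus\{i\})\cup\{j\}\notin\Delta$, and $C_{ij}(\sigma)=\sigma$ otherwise. A combinatorial shifted complex of $\Delta$ is any shifted complex of the form $\mathrm{Shift}_{i_qj_q}(\cdots(\mathrm{Shift}_{i_1j_1}(\Delta))\cdots)$ for a finite sequence of pairs $i_k<j_k$ in $[n]$. Let $V$ be a $K$-vector space with basis $e_1,\ldots,e_{15}$ and $E=\bigoplus_{d=0}^{15}\bigwedge^d(V)$. For $\sigma=\{j_1<\cdots<j_d\}$ put $e_\sigma=e_{j_1}\wedge\cdots\wedge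 e_{j_d}$. The exterior face ideal $J_\Delta\subset E$ is generated by the $e_\sigma$ with $\sigma\notin\Delta$; every monomial ideal of $E$ containing no $e_i$ is $J_\Delta$ for a unique $\Delta$. Let $<_{\mathrm{lex}}$ be the lexicographic order on monomials of $E$ induced by $e_1>\cdots>e_{15}$. Construction of $\Delta$. Put $h_1=e_1$, $h_2=e_2\wedge e_3$, $h_3=e_3\wedge e_4\wedge e_5$, $h_4=e_4\wedge\cdots\wedge e_7$, $h_5=e_5\wedge\cdots\wedge e_9$, $h_6=e_6\wedge\cdots\wedge e_{11}$. Define subsets of $\bigwedge^2(V)$: $H_3=\{e_{12}\wedge e_{13},\,e_{12}\wedge e_{15},\,e_{13}\wedge e_{14}\}$, $H_4=\{e_{12}\wedge e_{13},\,e_{12}\wedge e_{14},\,e_{14}\wedge e_{15}\}$, $H_5=\{e_{12}\wedge e_{13},\,e_{12}\wedge e_{15},\,e_{14}\wedge e_{15}\}$, $H_6=\{e_{12}\wedge e_{13},\,e_{13}\wedge e_{14},\,e_{14}\wedge e_{15}\}$, $H_7=\{e_{12}\wedge e_{13},\,e_{13}\wedge e_{15},\,e_{14}\wedge e_{15}\}$, $H_8=\{e_{12}\wedge e_{14},\,e_{13}\wedge e_{15},\,e_{14}\wedge e_{15}\}$. For $3\le i\le 8$ let $T_i=\{e_\sigma\in\bigwedge^i(V): h_{i-2}\wedge e_{12}\wedge e_{13}<_{\mathrm{lex}}e_\sigma\}$ and $T_i(H_i)=\{h_{i-2}\wedge e_\sigma: e_\sigma\in H_i\}$. Let $I\subset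 E$ be the ideal generated by the monomials in $\bigcup_{i=3}^8(T_i\cup T_i(H_i))$ together with all monomials of degree $9$. Then $\Delta$ is the simplicial complex on $\{1,\ldots,15\}$ with $I=J_\Delta$. *)

(* Defs.v *)
From HB Require Import structures.
From mathcomp Require Import all_boot all_order all_algebra.
From mathcomp.multinomials Require Import mpoly.

Set Implicit Arguments.
Unset Strict Implicit.
Unset Printing Implicit Defensive.

Import GRing.Theory.
Local Open Scope ring_scope.

(** The vertex set [{1, ..., n}] is represented by ['I_n], the vertex [k] being
    the ordinal of value [k - 1]. *)

(** * Simplicial complexes and combinatorial shifting *)

Section Complexes.
Variable n : nat.
Implicit Types (D : {set {set 'I_n}}) (s t : {set 'I_n}) (i j : 'I_n).

Definition simplicial_complex D : Prop :=
  (forall j, [set j] \in D) /\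
  (forall s t, s \in D -> t \subset s -> t \in D).

Definition shifted D : Prop :=
  forall s i j, s \in D -> i \in s -> (i < j)%N -> j \notin s ->
    j |: (s :\ i) \in D.

Definition shift_face D i j s : {set 'I_n} :=
  if [&& i \in s, j \notin s & j |: (s :\ i) \notin D]
  then j |: (s :\ i) else s.

Definition Shift i j D : {set {set 'I_n}} := [set shift_face D i j s | s in D].

(** [Dc] is a combinatorial shifted complex of [D]; the head of the sequence
    [p] is the pair shifted first. *)
Definition comb_shifted D Dc : Prop :=
  shifted Dc /\
  exists p : seq ('I_n * 'I_n),
    all (fun ij : 'I_n * 'I_n => (ij.1 < ij.2)%N) p /\
    Dc = foldl (fun X (ij : 'I_n * 'I_n) => Shift ij.1 ij.2 X) D p.

End Complexes.

(** * Exterior algebra *)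

Section Exterior.
Variables (K : fieldType) (n : nat).

(** The exterior algebra of [K^n] in its monomial basis: [f s] is the
    coefficient of [e_s] in [f]. *)
Definition exterior := {ffun {set 'I_n} -> K}.

Definition ext_mon (s : {set 'I_n}) : exterior := [ffun t => (t == s)%:R].

(** For disjoint [s] and [t], [e_s /\ e_t] is [(-1) ^ inversions s t] times
    [e_(s :|: t)]; it is zero when [s] and [t] meet. *)
Definition inversions (s t : {set 'I_n}) : nat :=
  #|[set p : 'I_n * 'I_n | [&& p.1 \in s, p.2 \in t & (p.2 < p.1)%N]]|.

Definition wedge (f g : exterior) : exterior :=
  [ffun r : {set 'I_n} => \sum_(s : {set 'I_n} | s \subset r)
     (-1) ^+ inversions s (r :\: s) * f s * g (r :\: s)].

Definition ext_ideal (J : exterior -> Prop) : Prop :=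
  [/\ J 0, forall f g, J f -> J g -> J (f + g),
      forall a f, J f -> J (wedge a f) & forall a f, J f -> J (wedge f a)].

Definition ext_ideal_gen (G : {set {set 'I_n}}) (f : exterior) : Prop :=
  forall J : exterior -> Prop, ext_ideal J ->
    (forall s, s \in G -> J (ext_mon s)) -> J f.

Definition exterior_face_ideal (D : {set {set 'I_n}}) : exterior -> Prop :=
  ext_ideal_gen (~: D).

End Exterior.

(** [lex_lt t s] is [e_t <lex e_s] for [e_1 > ... > e_n]; it is only meant for
    monomials of the same degree. *)
Definition lex_lt (n : nat) (t s : {set 'I_n}) : bool :=
  [exists x in s :\: t,
     [forall y : 'I_n, (y < x)%N ==> ((y \in s) == (y \in t))]].

(** * Stanley-Reisner ideals and graded Betti numbers *)

Definition stanley_reisner (K : fieldType) (n : nat) (D : {set {set 'I_n}})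
    (f : {mpoly K[n]}) : Prop :=
  exists c : {set 'I_n} -> {mpoly K[n]},
    f = \sum_(s | s \notin D) c s * \prod_(k in s) 'X_k.

Section Betti.
Variables (K : fieldType) (n : nat).
Local Notation S := {mpoly K[n]}.

(** [p] belongs to [S(-d)_j], the component of degree [j] of the free module of
    rank one with generator in degree [d]. *)
Definition in_twist (d j : nat) (p : S) : bool :=
  if (d <= j)%N then p \is (j - d).-homog else p == 0.

(** A resolution of [K = S / (x_1, ..., x_n)] by graded free [S]-modules of
    finite rank. The module [F_i] is the direct sum over [a] of
    [S(- res_deg i a)]. Its elements are row vectors, and the maps act by right
    multiplication. The augmentation is [v |-> \sum_a v_a(0) * res_aug a]. *)
Record graded_resolution := GradedResolution {
  res_rank : nat -> nat;
  res_deg : forall i, 'I_(res_rank i) -> nat;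
  res_diff : forall i, 'M[S]_(res_rank i.+1, res_rank i);
  res_aug : 'I_(res_rank 0) -> K;
  res_diff_homog : forall i a b,
    in_twist (res_deg b) (res_deg a) (res_diff i a b);
  res_aug_homog : forall a, res_aug a != 0 -> res_deg a = 0%N;
  res_aug_surj : exists a, res_aug a != 0;
  res_exact0 : forall v : 'rV[S]_(res_rank 0),
    \sum_a (v 0 a)@_0%MM * res_aug a = 0 <->
    exists w : 'rV[S]_(res_rank 1), v = w *m res_diff 0;
  res_exactS : forall i (v : 'rV[S]_(res_rank i.+1)),
    v *m res_diff i = 0 <->
    exists w : 'rV[S]_(res_rank i.+2), v = w *m res_diff i.+1
}.

Variables (F : graded_resolution) (M : S -> Prop).

(** For an ideal [M] of [S], the module tensor product of [F_i] and [M] is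
    identified with the vectors of [F_i] having all their entries in [M];
    [tensor_part i j] is its component of degree [j]. *)
Definition tensor_part (i j : nat) (v : 'rV[S]_(res_rank F i)) : Prop :=
  forall a, M (v 0 a) /\ in_twist (res_deg a) j (v 0 a).

Definition tensor_diff0 (i : nat) : 'rV[S]_(res_rank F i) -> Prop :=
  match i with
  | 0%N => fun _ => True
  | i'.+1 => fun v => v *m res_diff F i' = 0
  end.

Definition tor_cycle (i j : nat) (v : 'rV[S]_(res_rank F i)) : Prop :=
  tensor_part j v /\ tensor_diff0 v.

Definition tor_boundary (i j : nat) (v : 'rV[S]_(res_rank F i)) : Prop :=
  exists w : 'rV[S]_(res_rank F i.+1),
    tensor_part j w /\ v = w *m res_diff F i.

(** The [K]-vector space of cycles modulo boundaries has a basis with [b]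
    elements. *)
Definition tor_dim (i j b : nat) : Prop :=
  exists z : 'I_b -> 'rV[S]_(res_rank F i),
    (forall k, tor_cycle j (z k)) /\
    (forall v, tor_cycle j v -> exists! c : 'rV[K]_b,
       tor_boundary j (v - \sum_k (c 0 k)%:MP *: z k)).

End Betti.

(** [betti M i j b] is [dim_K Tor_i^S(K, M)_j = b], for a homogeneous ideal [M];
    by independence of the resolution, at most one [b] satisfies it. *)
Definition betti (K : fieldType) (n : nat) (M : {mpoly K[n]} -> Prop)
    (i j b : nat) : Prop :=
  exists F : graded_resolution K n, tor_dim F M i j b.

Definition betti_le (K : fieldType) (n : nat) (M N : {mpoly K[n]} -> Prop)
    (i j : nat) : Prop :=
  forall b c, betti M i j b -> betti N i j c -> (b <= c)%N.

(** * The generators of the ideal *)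

(** The set of the vertices, numbered from 1, that are listed in [l]. *)
Definition vset (l : seq nat) : {set 'I_15} := [set x : 'I_15 | x.+1 \in l].

Definition h (k : nat) : {set 'I_15} :=
  match k with
  | 1 => vset [:: 1]
  | 2 => vset [:: 2; 3]
  | 3 => vset [:: 3; 4; 5]
  | 4 => vset [:: 4; 5; 6; 7]
  | 5 => vset [:: 5; 6; 7; 8; 9]
  | 6 => vset [:: 6; 7; 8; 9; 10; 11]
  | _ => set0
  end%N.

Definition H (i : nat) : {set {set 'I_15}} :=
  match i with
  | 3 => [set vset [:: 12; 13]; vset [:: 12; 15]; vset [:: 13; 14]]
  | 4 => [set vset [:: 12; 13]; vset [:: 12; 14]; vset [:: 14; 15]]
  | 5 => [set vset [:: 12; 13]; vset [:: 12; 15]; vset [:: 14; 15]]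
  | 6 => [set vset [:: 12; 13]; vset [:: 13; 14]; vset [:: 14; 15]]
  | 7 => [set vset [:: 12; 13]; vset [:: 13; 15]; vset [:: 14; 15]]
  | 8 => [set vset [:: 12; 14]; vset [:: 13; 15]; vset [:: 14; 15]]
  | _ => set0
  end%N.

(** The sets [T_i] and [T_i(H_i)], a monomial [e_s] being represented by [s].
    Every element of [h (i - 2)] is less than 12, so the wedge products with
    [e_(h (i - 2))] below carry no sign. *)
Definition T (i : nat) : {set {set 'I_15}} :=
  [set s : {set 'I_15} |
     (#|s| == i) && lex_lt (h (i - 2) :|: vset [:: 12; 13]%N) s].

Definition TH (i : nat) : {set {set 'I_15}} :=
  [set h (i - 2) :|: s | s in H i].

Definition generators : {set {set 'I_15}} :=
  (\bigcup_(3 <= i < 9) (T i :|: TH i)) :|: [set s : {set 'I_15} | #|s| == 9%N].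

(* Main.v *)
Require Import Defs.
From HB Require Import structures.
From mathcomp Require Import all_boot all_order all_algebra.
From mathcomp.multinomials Require Import mpoly.
From mathcomp Require Import zify.

(** The vertices are 0-based in the code; in these comments they are numbered
from 1, as are the variables.

Why the theorem is true. In degree [d], for [3 <= d <= 8], the nonfaces of
[Delta] are the initial lexicographic segment [T d] and three sets
[h (d - 2) :|: {a, b}], where [{a, b}] runs over the edges of a graph [H d]
on the four vertices 12, 13, 14, 15. Shifting acts on each degree
separately. A shift [i < j] with [i <= 11] changes nothing, because
exchanging [j] for [i] makes any nonface lexicographically larger and so
leads into the segment ([Shift_head]); a shift inside {12, ..., 15} fixes
the segment and shifts the six graphs at the same time ([Shift_tail]). A
combinatorial shifted complex of [Delta] is therefore given by six graphs
with three edges on four vertices, each of which has become shifted, that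
is, the star of the vertex 12 or the triangle 12, 13, 14. As the six graphs
start differently and undergo the same shifts, not all choices are
reachable: the finite search [reachable_check] shows that every shifted
state has both a star and a triangle among its six graphs. On the other
hand every degree carries a star in one of them and a triangle in another
([star_witness], [triangle_witness]).

Only the Betti numbers of homological degree 0 are needed. The number
[betti I 0 j] counts the minimal nonfaces with [j] elements
([betti0_minimal_nonfaces]). The sets that the nonfaces of size [d] force
in size [d + 1] are those forced by the segment, and [h (d - 2)] with a
triple of {12, ..., 15} that contains an edge of the graph: all four triples
for the triangle, but not 13, 14, 15 for the star. So a star in degree [d]
gives a larger Betti number in degree [d + 1] than a triangle
([mnf_star_triangle]). A maximal complex would need six stars and a minimal
one six triangles.

The Betti numbers are those of a graded free resolution of [K], and the
Koszul complex is used. It is shown to be exact by a contracting homotopy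
over [K]: a monomial multiple of a basis element [e_t] is sent to its
quotient by [x_k] times [e_(k |: t)], when [k] is the smallest index that
occurs in either, is in the monomial and is not in [t]
([koszul_contract]). *)

(** * Splitting a polynomial by the first variable of its monomials *)

Section MonomialParts.
Set Implicit Arguments.
Unset Strict Implicit.
Unset Printing Implicit Defensive.
Import GRing.Theory.
Local Open Scope ring_scope.
Variables (K : fieldType) (n : nat).
Local Notation S := {mpoly K[n]}.
Implicit Types (p q : S) (k j l : 'I_n) (m : 'X_{1..n}).

Lemma mcoeffXM p j m :
  ('X_j * p)@_m = if (0 < m j)%N then p@_(m - U_(j)) else 0.
Proof.
case: ifPn => [mj|]; last first.
  rewrite -leqNgt leqn0 => /eqP mj; apply/eqP; rewrite mcoeff_eq0.
  rewrite mulrC (perm_mem (msuppMX _ _)); apply/mapP => -[m' _ mE].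
  by move: mj; rewrite mE mnmDE mnm1E eqxx.
have {1}-> : m = (U_(j) + (m - U_(j)))%MM.
  rewrite addmC submK //; apply/mnm_lepP => l; rewrite mnm1E.
  by case: eqP => // <-.
by rewrite mulrC mcoeffMX.
Qed.

Definition avoids k m := [forall l : 'I_n, (l < k)%N ==> (m l == 0%N)].

(** The image of [p] when the variables before [x_k] are set to 0. *)
Definition low k p : S :=
  \sum_(m <- msupp p | avoids k m) p@_m *: 'X_[m].

(** The part of [p] whose monomials have [x_k] as their first variable,
    divided by [x_k]. The maps [quo k] are linear over [K] only; they are
    the entries of the contracting homotopy. *)
Definition quo k p : S :=
  \sum_(m <- msupp p | avoids k m && (0 < m k)%N) p@_m *: 'X_[m - U_(k)].

(** The injectivity of [f] keeps the terms of the sum on distinct monomials. *)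
Lemma mcoeff_filter (P : pred 'X_{1..n}) (f : 'X_{1..n} -> 'X_{1..n}) p m :
  {in P &, injective f} -> P m ->
  (\sum_(m' <- msupp p | P m') p@_m' *: 'X_[f m'])@_(f m) = p@_m.
Proof.
move=> finj Pm; rewrite raddf_sum /= big_mkcond /=.
have E m' : (if P m' then (p@_m' *: 'X_[f m'])@_(f m) else 0) =
            if m' == m then p@_m else 0.
  case: ifPn => Pm'; last by case: eqP Pm' Pm => // -> /negP.
  rewrite mcoeffZ mcoeffX; have [->|ne] := eqVneq m' m; first by rewrite eqxx mulr1.
  by case: eqP => [/finj e|]; [case/eqP: ne; apply: e | rewrite mulr0].
under eq_bigr => m' _ do rewrite E.
have [mp|mp] := boolP (m \in msupp p).
  by rewrite (bigD1_seq m) ?msupp_uniq //= eqxx big1 ?addr0 // => m' /negbTE ->.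
rewrite big1 => [|m' _]; first by apply/esym/eqP; rewrite mcoeff_eq0.
by case: ifP => // _; apply/eqP; rewrite mcoeff_eq0.
Qed.

Lemma mcoeff_low k p m : (low k p)@_m = if avoids k m then p@_m else 0.
Proof.
case: ifPn => Am; first by rewrite /low mcoeff_filter.
rewrite /low raddf_sum /= big1 // => m' Am'; rewrite mcoeffZ mcoeffX.
by case: eqP Am' Am => [-> ->|] // _ _ _; rewrite mulr0.
Qed.

Lemma avoidsD k j m : (k <= j)%N -> avoids k (m + U_(j)) = avoids k m.
Proof.
move=> kj; apply: eq_forallb => l; rewrite mnmDE mnm1E.
by have [<-|_] := eqVneq j l; rewrite ?addn0 // ltnNge kj.
Qed.

Lemma mcoeff_quo k p m :
  (quo k p)@_m = if avoids k m then p@_(m + U_(k)) else 0.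
Proof.
case: ifPn => Am.
  have {1}-> : m = (m + U_(k) - U_(k))%MM by rewrite addmK.
  rewrite /quo (@mcoeff_filter _ (fun m => m - U_(k))%MM) //; last first.
    by rewrite avoidsD // Am mnmDE mnm1E eqxx addn1.
  move=> m1 m2 /andP[_ m1k] /andP[_ m2k] /= e.
  have U m' : (0 < m' k)%N -> m' = (m' - U_(k) + U_(k))%MM.
    move=> m'k; rewrite submK //; apply/mnm_lepP => l; rewrite mnm1E.
    by case: eqP => // <-.
  by rewrite (U _ m1k) (U _ m2k) e.
rewrite /quo raddf_sum /= big1 // => m' /andP[Am' _]; rewrite mcoeffZ mcoeffX.
case: eqP => [e|_]; last by rewrite mulr0.
case/negP: Am; rewrite -e; apply/forallP => l; apply/implyP => lk.
by rewrite mnmBE; move/forallP/(_ l)/implyP/(_ lk)/eqP: Am' ->.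
Qed.

Lemma quo_is_linear k : linear (quo k).
Proof.
move=> a p q; apply/mpolyP => m; rewrite mcoeffD mcoeffZ !mcoeff_quo.
by case: ifP => _; rewrite ?mcoeffD ?mcoeffZ // mulr0 addr0.
Qed.

HB.instance Definition _ k :=
  GRing.isLinear.Build K S S _ (quo k) (quo_is_linear k).

Lemma quo_mul_lt k j p : (j < k)%N -> quo k ('X_j * p) = 0.
Proof.
move=> jk; apply/mpolyP => m; rewrite mcoeff_quo mcoeff0; case: ifP => // Am.
rewrite mcoeffXM mnmDE mnm1E.
move/forallP/(_ j)/implyP/(_ jk)/eqP: Am ->.
by case: eqP jk => [->|]; rewrite ?ltnn.
Qed.

Lemma quo_mul_gt k j p : (k < j)%N -> quo k ('X_j * p) = 'X_j * quo k p.
Proof.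
move=> kj; apply/mpolyP => m; rewrite mcoeff_quo !mcoeffXM mcoeff_quo.
have nkj : k == j = false by case: eqP kj => // ->; rewrite ltnn.
rewrite mnmDE mnm1E nkj addn0; case: (ltnP 0 (m j)) => [mj|]; last by rewrite if_same.
have mE : m = (m - U_(j) + U_(j))%MM.
  rewrite submK //; apply/mnm_lepP => l; rewrite mnm1E.
  by case: eqP => // <-.
have -> : avoids k m = avoids k (m - U_(j)) by rewrite [in LHS]mE avoidsD // ltnW.
have -> : (m + U_(k) - U_(j) = m - U_(j) + U_(k))%MM; last by case: ifP.
apply/mnmP => l; rewrite !(mnmDE, mnmBE, mnm1E).
by have [<-|_] := eqVneq j l; rewrite ?nkj ?addn0 ?subn0.
Qed.

Lemma quo_mul_eq k p : quo k ('X_k * p) = low k p.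
Proof.
apply/mpolyP => m; rewrite mcoeff_quo mcoeff_low mcoeffXM mnmDE mnm1E eqxx addn1.
by rewrite addmK.
Qed.

Lemma mcoeff_Xquo k p m : ('X_k * quo k p)@_m =
  if avoids k m && (0 < m k)%N then p@_m else 0.
Proof.
rewrite mcoeffXM andbC; case: ltnP => //= mk; rewrite mcoeff_quo.
have mE : m = (m - U_(k) + U_(k))%MM.
  rewrite submK //; apply/mnm_lepP => l; rewrite mnm1E.
  by case: eqP => // <-.
by rewrite [in X in _ = (if X then _ else _)]mE avoidsD // -mE.
Qed.

(** At most one variable is the first one of a monomial. *)
Lemma sum_first m (P : pred 'I_n) (x : K) :
  (\sum_(j | P j && (avoids j m && (0 < m j)%N)) x) =
  if [exists j, P j && (0 < m j)%N && avoids j m] then x else 0.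
Proof.
case: existsP => [[j /andP[/andP[Pj mj] Aj]]|none].
  rewrite (big_pred1 j) // => l /=; apply/idP/eqP => [/and3P[Pl Al ml]|->]; last first.
    by rewrite Pj Aj.
  apply/val_inj; case: (ltngtP l j) => // lj.
    by move/forallP/(_ l)/implyP/(_ lj)/eqP: Aj ml => ->.
  by move/forallP/(_ j)/implyP/(_ lj)/eqP: Al mj => ->.
rewrite big_pred0 // => j; apply/negP => /and3P[Pj Aj mj]; case: none.
by exists j; rewrite Pj mj.
Qed.

Lemma first_var m (P : pred 'I_n) : (forall i j : 'I_n, (i < j)%N -> P j -> P i) ->
  [exists j, P j && (0 < m j)%N && avoids j m] = ~~ [forall j, P j ==> (m j == 0%N)].
Proof.
move=> Pdown; rewrite negb_forall; apply/existsP/existsP.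
  by case=> j /andP[/andP[Pj mj] _]; exists j; rewrite Pj -lt0n.
case=> j; rewrite negb_imply -lt0n => Hj.
case: (@arg_minnP _ j (fun i => P i && (0 < m i)%N)
  (fun i : 'I_n => i : nat) Hj) => i /andP[Pi mi] imin.
exists i; rewrite Pi mi /=; apply/forallP => l; apply/implyP => li.
apply/negPn/negP => ml; have := imin l; rewrite (Pdown _ _ li Pi) lt0n ml => /(_ isT).
by rewrite leqNgt li.
Qed.

Lemma low_decomp k p :
  \sum_(j : 'I_n | (j < k)%N) 'X_j * quo j p + low k p = p.
Proof.
apply/mpolyP => m; rewrite mcoeffD mcoeff_low raddf_sum /=.
under eq_bigr => j _ do rewrite mcoeff_Xquo.
rewrite -big_mkcondr sum_first first_var; last by move=> i j ij; apply: ltn_trans.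
by rewrite -/(avoids k m); case: avoids => /=; rewrite ?add0r ?addr0.
Qed.

Lemma const_decomp p : \sum_j 'X_j * quo j p = p - (p@_0)%:MP.
Proof.
apply/mpolyP => m; rewrite mcoeffB mcoeffC raddf_sum /=.
under eq_bigr => j _ do rewrite mcoeff_Xquo.
rewrite -big_mkcond (@sum_first m xpredT) first_var //.
have -> : [forall j : 'I_n, true ==> (m j == 0%N)] = (m == 0)%MM.
  apply/forallP/eqP => [m0|-> j]; last by rewrite mnm0E.
  by apply/mnmP => j; rewrite mnm0E; apply/eqP/m0.
by case: eqP => [->|_] /=; rewrite ?mulr1 ?subrr ?mulr0 ?subr0.
Qed.

End MonomialParts.
(** * The Koszul complex and its contracting homotopy *)

Section Koszul.
Set Implicit Arguments.
Unset Strict Implicit.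
Unset Printing Implicit Defensive.
Import GRing.Theory.
Local Open Scope ring_scope.
Variables (K : fieldType) (n : nat).
Local Notation S := {mpoly K[n]}.
Implicit Types (s t : {set 'I_n}) (j k l : 'I_n) (v : {set 'I_n} -> S).

(** The place of [j] in the increasing list of [j |: t], which gives the sign
    of [e_j] in the differential. *)
Definition pos j t : nat := #|[set l in t | (l < j)%N]|.

Definition ksign j t : K := (-1) ^+ pos j t.

(** Elements of all the modules of the Koszul complex are families indexed by
    all subsets, so that no identity below carries a homological degree. *)
Definition koszul v t : S :=
  \sum_(j | j \notin t) ksign j t *: ('X_j * v (j |: t)).

Definition least t : option 'I_n :=
  [pick k in t | [forall l in t, (k <= l)%N]].

(** The homotopy: the entry at [t] comes from the entry at [t] without its
    least element [k], by the monomials whose first variable is [x_k]. *)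
Definition contract v t : S :=
  if least t is Some k then quo k (v (t :\ k)) else 0.

Lemma leastP t k :
  k \in t -> (forall l, l \in t -> (k <= l)%N) -> least t = Some k.
Proof.
move=> kt kmin; rewrite /least; case: pickP => [k' /andP[k't /forallP k'min]|].
  congr Some; apply/val_inj/eqP; rewrite eqn_leq kmin // andbT.
  by have := k'min k; rewrite kt.
move/(_ k); rewrite kt /= => /negP[]; apply/forallP => l.
by apply/implyP => /kmin.
Qed.

Lemma least_set0 : least set0 = None.
Proof. by rewrite /least; case: pickP => // k; rewrite inE. Qed.

Lemma least_exists t : t != set0 ->
  exists2 k, k \in t & forall l, l \in t -> (k <= l)%N.
Proof.
case/set0Pn => j jt.
case: (@arg_minnP _ j (fun i => i \in t) (fun i : 'I_n => i : nat) jt) => k kt kmin.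
by exists k.
Qed.

Lemma pos_setU1 j k t : k \notin t -> pos j (k |: t) = ((k < j) + pos j t)%N.
Proof.
move=> kt; rewrite /pos; case: ltnP => kj /=.
  have -> : [set l in k |: t | (l < j)%N] = k |: [set l in t | (l < j)%N].
    by apply/setP => l; rewrite !inE; case: eqP => [->|].
  by rewrite cardsU1 inE (negbTE kt).
rewrite add0n; congr #|pred_of_set _|; apply/setP => l; rewrite !inE.
by case: eqP => [->|] //=; rewrite [(k < j)%N]ltnNge kj andbF.
Qed.

Lemma pos_min k t : (forall l, l \in t -> (k <= l)%N) -> pos k t = 0%N.
Proof.
move=> kmin; apply/eqP; rewrite cards_eq0; apply/eqP/setP => l; rewrite !inE.
by apply/negP => /andP[/kmin kl]; rewrite ltnNge kl.
Qed.

(** The terms that remove [j] then [l], and [l] then [j], have opposite signs.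
    They are paired explicitly so that the argument holds in
    characteristic 2. *)
Lemma koszulK v t : koszul (koszul v) t = 0.
Proof.
pose F j l := ksign j t *: ('X_j * (ksign l (j |: t) *: ('X_l * v (l |: (j |: t))))).
have anti j l : j \notin t -> l \notin t -> (j < l)%N -> F j l + F l j = 0.
  move=> jt lt jl; rewrite /F /ksign !pos_setU1 // jl ltnNge ltnW //= add0n add1n.
  rewrite setUCA -!scalerAr !scalerA exprS mulN1r mulrN scaleNr mulrC.
  by rewrite !mulrA ['X_j * _]mulrC addrC subrr.
transitivity (\sum_(j | j \notin t) \sum_(l | (l \notin t) && (l != j)) F j l).
  apply: eq_bigr => j jt; rewrite mulr_sumr scaler_sumr.
  by apply: eq_bigl => l; rewrite !inE negb_or andbC.
transitivity (\sum_(j | j \notin t) \sum_(l | (l \notin t) && (j < l)%N) F j l +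
              \sum_(j | j \notin t) \sum_(l | (l \notin t) && (l < j)%N) F j l).
  rewrite -big_split; apply: eq_bigr => j jt /=.
  rewrite (bigID (fun l : 'I_n => (j < l)%N)) /=; congr (_ + _); apply: eq_bigl => l.
    by rewrite -andbA; case: (ltnP j l) => [jl|]; rewrite ?andbF // neq_ltn jl orbT.
  by rewrite -andbA -leqNgt -ltn_neqAle.
(* The two halves of the double sum become one sum over pairs j < l. *)
rewrite (exchange_big_dep (fun l => l \notin t)) /=; last by move=> j l _ /andP[].
rewrite -big_split big1 // => l lt /=.
rewrite [X in X + _](eq_bigl (fun j => (j \notin t) && (j < l)%N)); last first.
  by move=> j; rewrite lt.
rewrite -big_split big1 // => j /andP[jt jl] /=.
exact: anti.
Qed.

(** With [k] the least element of [t], the variables [x_j] with [j < k] are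
    recovered by [koszul] after [contract] and the rest, [low k], by
    [contract] after [koszul]; the terms with [j > k] cancel because inserting
    [k] below [j] reverses the sign of [j]. *)
Lemma koszul_contract v t :
  koszul (contract v) t + contract (koszul v) t =
  v t - (if t == set0 then ((v t)@_0)%:MP else 0).
Proof.
have [->|t0] := eqVneq t set0.
  rewrite [contract _ _]/contract least_set0 addr0 -const_decomp /koszul.
  apply: eq_big => [j|j _]; first by rewrite inE.
  rewrite /ksign pos_min => [|l]; last by rewrite inE.
  rewrite expr0 scale1r /contract setU0 (@leastP _ j) ?set11 //.
    by rewrite setDv.
  by move=> l /set1P ->.
have [k kt kmin] := least_exists t0; rewrite subr0.
have -> : contract (koszul v) t =
  low k (v t) - \sum_(j | (j \notin t) && (k < j)%N)
                  ksign j t *: ('X_j * quo k (v (j |: t :\ k))).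
  rewrite /contract (leastP kt kmin) /koszul raddf_sum (bigD1 k) /=; last first.
    by rewrite !inE eqxx.
  rewrite setD1K // linearZ /= quo_mul_eq /ksign pos_min; last first.
    by move=> l /setD1P[_ /kmin].
  rewrite expr0 scale1r; congr (_ + _).
  rewrite (bigID (fun j : 'I_n => (k < j)%N)) /= [X in _ + X]big1 ?addr0; last first.
    move=> j /andP[/andP[_ jk]]; rewrite -leqNgt => jk'.
    by rewrite linearZ /= quo_mul_lt ?scaler0 // ltn_neqAle jk' andbT.
  rewrite -sumrN; apply: eq_big => [j|j /andP[/andP[jt _] kj]].
    rewrite !inE; have [->|jk] /= := eqVneq j k; first by rewrite kt ltnn.
    by rewrite andbT.
  rewrite linearZ /= quo_mul_gt // -scaleNr; congr (_ *: _).
  rewrite -[in RHS](setD1K kt) pos_setU1 ?setD11 // kj exprS mulN1r.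
  by rewrite opprK.
have -> : koszul (contract v) t = \sum_(j : 'I_n | (j < k)%N) 'X_j * quo j (v t) +
    \sum_(j | (j \notin t) && (k < j)%N)
                  ksign j t *: ('X_j * quo k (v (j |: t :\ k))).
  rewrite /koszul (bigID (fun j : 'I_n => (j < k)%N)) /=; congr (_ + _).
    apply: eq_big => [j|j /andP[jt jk]].
      by rewrite andb_idl // => jk; apply/negP => /kmin; rewrite leqNgt jk.
    rewrite /contract (@leastP _ j) ?setU11 //; last first.
      by move=> l /setU1P[->//|/kmin]; apply: leq_trans; apply: ltnW.
    rewrite setU1K // /ksign pos_min ?expr0 ?scale1r // => l /kmin.
    by apply: leq_trans; apply: ltnW.
  apply: eq_big => [j|j /andP[jt jk]].
    rewrite -leqNgt leq_eqVlt; case: eqP => [/val_inj <-|] //=.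
    by rewrite kt.
  rewrite -leqNgt in jk.
  rewrite /contract (@leastP _ k) ?inE ?kt ?orbT //; last first.
    by move=> l /setU1P[->//|/kmin].
  congr (_ *: (_ * quo k (v _))); apply/setP => l; rewrite !inE.
  by have [->|] := eqVneq l k => //=; case: eqP jt => // <-; rewrite kt.
by rewrite addrACA subrr addr0 low_decomp.
Qed.

End Koszul.

(** * The Koszul resolution *)

Section KoszulResolution.
Set Implicit Arguments.
Unset Strict Implicit.
Unset Printing Implicit Defensive.
Import GRing.Theory.
Local Open Scope ring_scope.
Variables (K : fieldType) (n : nat).
Local Notation S := {mpoly K[n]}.
Implicit Types (s t : {set 'I_n}) (j k l : 'I_n) (v : {set 'I_n} -> S).

Definition ksets (i : nat) : {set {set 'I_n}} := [set s : {set 'I_n} | #|s| == i].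

Definition krank i : nat := #|ksets i|.

Definition kset i (a : 'I_(krank i)) : {set 'I_n} := enum_val a.

Lemma card_kset i (a : 'I_(krank i)) : #|kset a| = i.
Proof. by have := enum_valP a; rewrite inE => /eqP. Qed.

Lemma kset_inj i : injective (@kset i).
Proof. exact: enum_val_inj. Qed.

Lemma ksetP i s : #|s| = i -> exists a : 'I_(krank i), s = kset a.
Proof.
move=> si; have sk : s \in ksets i by rewrite inE si.
by exists (enum_rank_in sk s); rewrite /kset enum_rankK_in.
Qed.

(** The homological degree is fixed by restricting families to the
    [i]-subsets; [extend] and [restrict] pass between the vectors of a
    resolution and families supported on the [i]-subsets. *)
Definition extend i (w : 'rV[S]_(krank i)) s : S :=
  \sum_a if s == kset a then w 0 a else 0.

Definition restrict i v : 'rV[S]_(krank i) := \row_a v (kset a).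

Definition supported i v := forall s, #|s| != i -> v s = 0.

Lemma extend_kset i (w : 'rV[S]_(krank i)) a : extend w (kset a) = w 0 a.
Proof.
rewrite /extend (bigD1 a) //= eqxx big1 ?addr0 // => b ba.
by case: eqP => // /kset_inj e; rewrite e eqxx in ba.
Qed.

Lemma extendK i : cancel (@extend i) (@restrict i).
Proof. by move=> w; apply/rowP => a; rewrite mxE extend_kset. Qed.

Lemma extend_supported i (w : 'rV[S]_(krank i)) : supported i (extend w).
Proof.
move=> s si; rewrite /extend big1 // => a _; case: eqP => // e.
by rewrite e card_kset eqxx in si.
Qed.

Lemma restrictK i v : supported i v -> extend (restrict i v) =1 v.
Proof.
move=> vi s; have [/ksetP[a ->]|si] := eqVneq #|s| i.
  by rewrite extend_kset mxE.
by rewrite extend_supported // vi.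
Qed.

Lemma eq_supported i v v' : supported i v -> supported i v' ->
  (forall a : 'I_(krank i), v (kset a) = v' (kset a)) -> v =1 v'.
Proof.
move=> vi vi' e s; have [/ksetP[a ->]//|si] := eqVneq #|s| i.
by rewrite vi ?vi'.
Qed.

Lemma koszul_ext (v v' : {set 'I_n} -> S) : v =1 v' -> koszul v =1 koszul v'.
Proof. by move=> e t; apply: eq_bigr => j _; rewrite e. Qed.

Lemma contract_ext (v v' : {set 'I_n} -> S) : v =1 v' -> contract v =1 contract v'.
Proof. by move=> e t; rewrite /contract; case: least => // k; rewrite e. Qed.

Lemma koszul_supported i v : supported i.+1 v -> supported i (koszul v).
Proof.
move=> vi s si; rewrite /koszul big1 // => j js.
by rewrite vi ?mulr0 ?scaler0 // cardsU1 js.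
Qed.

Lemma contract_supported i v : supported i v -> supported i.+1 (contract v).
Proof.
move=> vi s si; rewrite /contract /least; case: pickP => // k /andP[ks _].
by rewrite vi ?raddf0 //; rewrite (cardsD1 k) ks in si.
Qed.

Definition kdiff i : 'M[S]_(krank i.+1, krank i) :=
  \matrix_(a, b) \sum_(j | j \notin kset b)
     if j |: kset b == kset a then ksign K j (kset b) *: 'X_j else 0.

Lemma extend_kdiff i (w : 'rV[S]_(krank i.+1)) :
  extend (w *m kdiff i) =1 koszul (extend w).
Proof.
apply: eq_supported => [|//|b].
- exact: extend_supported.
- by apply: koszul_supported; apply: extend_supported.
rewrite extend_kset mxE; under eq_bigr => a _ do rewrite mxE mulr_sumr.
rewrite exchange_big; apply: eq_bigr => j jb.
rewrite /extend mulr_sumr scaler_sumr; apply: eq_bigr => a _.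
by case: ifP => _; rewrite ?mulr0 ?scaler0 // scalerAl mulrC.
Qed.

Lemma kdiffE i v : supported i.+1 v -> restrict i.+1 v *m kdiff i = restrict i (koszul v).
Proof.
move=> vi; rewrite -[LHS]extendK; apply/rowP => a; rewrite !mxE extend_kdiff.
exact/koszul_ext/restrictK.
Qed.

Lemma kset0 (a : 'I_(krank 0)) : kset a = set0.
Proof. by apply: cards0_eq; apply: card_kset. Qed.

Lemma kdiff_homog i (a : 'I_(krank i.+1)) (b : 'I_(krank i)) :
  in_twist i i.+1 (kdiff i a b).
Proof.
rewrite /in_twist leqnSn subSnn mxE; apply: rpred_sum => j _.
by case: ifP => _; rewrite ?dhomog0 // dhomogZ // dhomogX /= mdeg1.
Qed.

Lemma kaug_surj : exists a : 'I_(krank 0), (1 : K) != 0.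
Proof. by have [a _] := ksetP (cards0 'I_n); exists a; rewrite oner_neq0. Qed.

(** On a cycle of positive homological degree, [koszul_contract] reads
    [koszul (contract v) = v]. *)
Lemma kexactS i (v : 'rV[S]_(krank i.+1)) :
  v *m kdiff i = 0 <-> exists w : 'rV[S]_(krank i.+2), v = w *m kdiff i.+1.
Proof.
split=> [v0|[w ->]].
  exists (restrict i.+2 (contract (extend v))).
  rewrite kdiffE; last by apply/contract_supported/extend_supported.
  rewrite -[LHS]extendK; apply/rowP => a; rewrite !mxE.
  have := koszul_contract (extend v) (kset a).
  rewrite ifN -?card_gt0 ?card_kset // subr0 => <-.
  rewrite [X in _ + X](_ : _ = 0) ?addr0 //.
  rewrite -(contract_ext (extend_kdiff v)) v0 /contract; case: least => // k.
  by rewrite -[RHS](raddf0 (quo k)); congr quo; rewrite /extend big1 // => b _; rewrite mxE if_same.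
rewrite -[LHS]extendK; apply/rowP => a; rewrite !mxE extend_kdiff.
by rewrite (koszul_ext (extend_kdiff w)) koszulK.
Qed.

Lemma ksum0 (f : 'I_(krank 0) -> K) a : \sum_b f b = f a.
Proof.
rewrite (bigD1 a) //= big1 ?addr0 // => b /eqP[]; apply: kset_inj.
by rewrite !kset0.
Qed.

Lemma kexact0 (v : 'rV[S]_(krank 0)) :
  \sum_a (v 0 a)@_0%MM * 1 = 0 <->
  exists w : 'rV[S]_(krank 1), v = w *m kdiff 0.
Proof.
split=> [v0|[w ->]].
  exists (restrict 1 (contract (extend v))).
  rewrite kdiffE; last by apply/contract_supported/extend_supported.
  rewrite -[LHS]extendK; apply/rowP => a; rewrite !mxE.
  have := koszul_contract (extend v) (kset a).
  rewrite (ksum0 _ a) mulr1 in v0.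
  rewrite kset0 eqxx -(kset0 a) extend_kset v0 mpolyC0 subr0 => <-.
  by rewrite /contract kset0 least_set0 addr0.
apply: big1 => a _; rewrite mulr1 -extend_kset extend_kdiff /koszul raddf_sum big1 // => j _.
by rewrite /= mcoeffZ mcoeffXM mnm0E mulr0.
Qed.

Definition koszul_resolution : graded_resolution K n :=
  @GradedResolution K n krank (fun i _ => i) kdiff (fun _ => 1)
    kdiff_homog (fun _ _ => erefl) kaug_surj kexact0 kexactS.

End KoszulResolution.

(** * Generators of a Stanley-Reisner ideal *)

Section MinimalNonfaces.
Set Implicit Arguments.
Unset Strict Implicit.
Unset Printing Implicit Defensive.
Import GRing.Theory.
Local Open Scope ring_scope.
Variables (K : fieldType) (n : nat) (D : {set {set 'I_n}}).
Local Notation S := {mpoly K[n]}.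
Implicit Types (s t : {set 'I_n}) (k l : 'I_n) (m : 'X_{1..n}) (p : S).

Hypothesis D_down : forall s t, s \in D -> t \subset s -> t \in D.

(** The face of the monomial [m]: it lies in the Stanley-Reisner ideal exactly
    when this set is a nonface. *)
Definition msupport m : {set 'I_n} := [set k | (0 < m k)%N].

Definition mset s : 'X_{1..n} := [multinom (k \in s : nat) | k < n].

Lemma msetK : cancel mset msupport.
Proof. by move=> s; apply/setP => k; rewrite inE mnmE lt0b. Qed.

Lemma prod_mset s : \prod_(k in s) 'X_k = 'X_[mset s] :> S.
Proof.
rewrite mpolyXE_id big_mkcond; apply: eq_bigr => k _; rewrite mnmE.
by case: (k \in s).
Qed.

Lemma mdeg_mset s : mdeg (mset s) = #|s|.
Proof.
rewrite mdegE -sum1_card [in RHS]big_mkcond; apply: eq_bigr => k _; rewrite mnmE.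
by case: (k \in s).
Qed.

Lemma mset_le m s : (mset s <= m)%MM = (s \subset msupport m).
Proof.
apply/mnm_lepP/subsetP => [le k ks|sub k].
  by have := le k; rewrite mnmE ks inE.
by rewrite mnmE; case: (boolP (k \in s)) => // /sub; rewrite inE.
Qed.

(** A monomial is divisible by [x_s] for a nonface [s] exactly when its
    support is a nonface, as faces are closed under taking subsets. *)
Lemma stanley_reisnerP p :
  stanley_reisner D p <-> {in msupp p, forall m, msupport m \notin D}.
Proof.
split=> [[c ->] m|pD].
  rewrite mcoeff_msupp raddf_sum /= => nz; apply/negP => mD; case/eqP: nz.
  apply: big1 => s sD; rewrite prod_mset; apply/eqP; rewrite mcoeff_eq0.
  rewrite (perm_mem (msuppMX _ _)); apply/mapP => -[m' _ mE].
  case/negP: sD; apply: (D_down mD); rewrite -mset_le mE.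
  exact: lem_addr.
exists (fun s => \sum_(m <- msupp p | msupport m == s) p@_m *: 'X_[m - mset s]).
under eq_bigr => s _ do rewrite prod_mset mulr_suml.
rewrite (exchange_big_dep xpredT) //= {1}[p]mpolyE; apply: eq_big_seq => m /pD mD.
rewrite (big_pred1 (msupport m)) => [|s]; last first.
  by rewrite /= eq_sym; case: eqVneq => [->|]; rewrite ?mD ?andbF.
by rewrite -scalerAl -mpolyXD submK // mset_le.
Qed.

Definition minimal_nonfaces (j : nat) : {set {set 'I_n}} :=
  [set s : {set 'I_n} |
    [&& #|s| == j, s \notin D & [forall k in s, s :\ k \in D]]].

(** The monomial [m] is a variable times a monomial of the ideal, that is, it
    lies in the product of the ideal by the maximal ideal. *)
Definition reducible m := [exists k, (0 < m k)%N && (msupport (m - U_(k)) \notin D)].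

Lemma msupportBU m k : (1 < m k)%N -> msupport (m - U_(k)) = msupport m.
Proof.
move=> mk; apply/setP => l; rewrite !inE mnmBE mnm1E subn_gt0.
by case: eqP => // <-; rewrite mk ltnW.
Qed.

Lemma msetBU s k : k \in s -> msupport (mset s - U_(k)) = s :\ k.
Proof.
move=> ks; apply/setP => l; rewrite !inE mnmBE mnm1E mnmE subn_gt0 eq_sym.
by case: eqP => [->|] /=; rewrite ?ks // lt0b.
Qed.

Lemma irreducible_mset s : [forall k in s, s :\ k \in D] -> ~~ reducible (mset s).
Proof.
move/forall_inP => smin; apply/existsP => -[k /andP[]].
by rewrite mnmE lt0b => ks; rewrite msetBU // smin.
Qed.

(** An exponent above 1, or a support that stays a nonface after
    removing a vertex, would give a variable that can be divided out. *)
Lemma irreducible_minimal m : msupport m \notin D -> ~~ reducible m ->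
  msupport m \in minimal_nonfaces (mdeg m) /\ m = mset (msupport m).
Proof.
move=> mD /existsPn mred.
have m1 k : (m k <= 1)%N.
  rewrite leqNgt; apply/negP => mk; have := mred k.
  by rewrite ltnW // msupportBU // mD.
have mE : m = mset (msupport m).
  by apply/mnmP => k; rewrite mnmE inE; have := m1 k; case: (m k) => [|[]].
split=> //; rewrite inE mD /= {2}mE mdeg_mset eqxx /=.
apply/forall_inP => k ks; have := mred k; rewrite -msetBU // -mE.
by rewrite inE in ks; rewrite ks /= negbK.
Qed.

Local Notation F := (koszul_resolution K n).
Local Notation SR := (@stanley_reisner K n D).

Lemma rV0P (v w : 'rV[S]_(krank n 0)) a : v 0 a = w 0 a -> v = w.
Proof.
move=> e; apply/rowP => b; suff -> : b = a by [].
by apply: kset_inj; rewrite !kset0.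
Qed.

Lemma kdiff0E (w : 'rV[S]_(krank n 1)) a :
  (w *m kdiff K n 0) 0 a = \sum_k 'X_k * extend w [set k].
Proof.
rewrite -extend_kset extend_kdiff kset0; apply: eq_big => [k|k _]; first by rewrite inE.
rewrite /ksign pos_min => [|l]; last by rewrite inE.
by rewrite expr0 scale1r setU0.
Qed.

(** In homological degree 0 the boundaries are the elements of the product
    of the ideal by the maximal ideal, and this is a monomial condition: see
    also [reducible_boundary]. *)
Lemma boundary_reducible j (v : 'rV[S]_(krank n 0)) a :
  @tor_boundary K n F SR 0 j v -> {in msupp (v 0 a), forall m, reducible m}.
Proof.
case=> w [wM ->] m; rewrite mcoeff_msupp kdiff0E raddf_sum /= => nz.
apply: contraR nz => /existsPn mred; apply/eqP; apply: big1 => k _.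
rewrite mcoeffXM; case: ifP => // mk; apply/eqP; rewrite mcoeff_eq0.
have [b ->] := ksetP (cards1 k); rewrite extend_kset.
apply/negP => mb; have [/stanley_reisnerP/(_ _ mb) mD _] := wM b.
by have := mred k; rewrite mk mD.
Qed.

Lemma boundary0 j : @tor_boundary K n F SR 0 j 0.
Proof.
exists 0; rewrite mul0mx; split=> // a; rewrite mxE; split.
  by apply/stanley_reisnerP => m; rewrite msupp0.
by rewrite /in_twist; case: ifP; rewrite ?dhomog0.
Qed.

Lemma boundaryD j v v' : @tor_boundary K n F SR 0 j v ->
  @tor_boundary K n F SR 0 j v' -> @tor_boundary K n F SR 0 j (v + v').
Proof.
case=> w [wM ->] [w' [wM' ->]]; exists (w + w'); rewrite mulmxDl; split=> // a.
rewrite mxE; have [/stanley_reisnerP SRa ha] := wM a.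
have [/stanley_reisnerP SRa' ha'] := wM' a; split.
  apply/stanley_reisnerP => m /msuppD_le; rewrite mem_cat.
  by case/orP; [apply: SRa | apply: SRa'].
move: ha ha'; rewrite /in_twist; case: ifP => _; first by apply: dhomogD.
by move=> /eqP -> /eqP ->; rewrite addr0.
Qed.

Lemma reducible_boundary j (v : 'rV[S]_(krank n 0)) a :
  v 0 a \is j.-homog -> {in msupp (v 0 a), forall m, reducible m} ->
  @tor_boundary K n F SR 0 j v.
Proof.
move=> vj vred.
have -> : v = \sum_(m <- msupp (v 0 a)) const_mx ((v 0 a)@_m *: 'X_[m]).
  apply: (@rV0P _ _ a); rewrite {1}[v 0 a]mpolyE summxE.
  by apply: eq_bigr => m _; rewrite mxE.
rewrite big_seq; elim/big_rec: _ => [|m v' mv]; first exact: boundary0.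
apply: boundaryD; have /existsP[k /andP[mk mD]] := vred m mv.
have mE : m = (U_(k) + (m - U_(k)))%MM.
  rewrite addmC submK //; apply/mnm_lepP => l; rewrite mnm1E.
  by case: eqP => // <-.
pose f s : S := if s == [set k] then (v 0 a)@_m *: 'X_[m - U_(k)] else 0.
have f1 : supported 1 f.
  by move=> s; rewrite /f; case: (eqVneq s [set k]) => // ->; rewrite cards1.
exists (restrict 1 f); split=> [b|].
  rewrite mxE /f; case: eqP => _; split.
  - apply/stanley_reisnerP => m' /msuppZ_le; rewrite msuppX inE => /eqP -> //.
  - have jE : j = (mdeg (m - U_(k))).+1.
      by rewrite -(dhomog_mf vj mv) [in LHS]mE /= mdegD mdeg1.
    by rewrite /in_twist /= jE dhomogZ // dhomogX /= subn1.
  - by apply/stanley_reisnerP => m'; rewrite msupp0.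
  - by rewrite /in_twist; case: ifP; rewrite ?dhomog0.
apply: (@rV0P _ _ a); rewrite mxE kdiff0E (bigD1 k) //= big1 ?addr0 => [|l lk].
  by rewrite restrictK // /f eqxx -scalerAr -mpolyXD -mE.
by rewrite restrictK // /f (inj_eq set1_inj) (negbTE lk) mulr0.
Qed.

(** The squarefree monomials of the minimal nonfaces with [j] elements
    are a basis of the degree [j] part of the ideal modulo its product by the
    maximal ideal: the coordinates of an element are its coefficients at these
    monomials, the other monomials of the ideal being reducible. *)
Lemma betti0_minimal_nonfaces j : betti SR 0 j #|minimal_nonfaces j|.
Proof.
have [a0 _] := ksetP (cards0 'I_n).
pose z (k : 'I_#|minimal_nonfaces j|) : 'rV[S]_(krank n 0) :=
  const_mx 'X_[mset (enum_val k)].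
have zP (k : 'I_#|minimal_nonfaces j|) : [/\ #|enum_val k| = j, enum_val k \notin D &
  [forall l in enum_val k, enum_val k :\ l \in D]].
  by have := enum_valP k; rewrite inE => /and3P[/eqP].
have mset_inj : injective mset by apply: can_inj msetK.
have coef (c : 'rV[K]_#|minimal_nonfaces j|) v :
    (v - \sum_(k < #|minimal_nonfaces j|) (c 0 k)%:MP *: z k : 'rV[S]_(krank n 0)) 0 a0 =
    v 0 a0 - \sum_(k < #|minimal_nonfaces j|) c 0 k *: 'X_[mset (enum_val k)].
  rewrite !mxE summxE; congr (_ - _); apply: eq_bigr => k _.
  by rewrite !mxE mul_mpolyC.
have coef_z (c : 'rV[K]_#|minimal_nonfaces j|) (k : 'I_#|minimal_nonfaces j|) :
    (\sum_(k < #|minimal_nonfaces j|) c 0 k *: 'X_[mset (enum_val k)] : S)@_(mset (enum_val k))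
    = c 0 k.
  rewrite raddf_sum (bigD1 k) //= mcoeffZ mcoeffX eqxx mulr1 big1 ?addr0 // => l lk.
  rewrite mcoeffZ mcoeffX; case: eqP; rewrite ?mulr0 //.
  by move=> /mset_inj/enum_val_inj e; rewrite e eqxx in lk.
exists F, z; split=> [k|v [vM _]].
  split=> // a; rewrite mxE; split.
    apply/stanley_reisnerP => m; rewrite msuppX inE => /eqP ->.
    by rewrite msetK; case: (zP k).
  by rewrite /in_twist /= subn0 dhomogX /= mdeg_mset; case: (zP k) => ->.
have [/stanley_reisnerP vD] := vM a0; rewrite /in_twist /= subn0 => vj.
exists (\row_(k < #|minimal_nonfaces j|) (v 0 a0)@_(mset (enum_val k))); split=> [|c cb].
  apply: (@reducible_boundary _ _ a0); rewrite coef.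
    apply: rpredB => //; apply: rpred_sum => k _; apply: dhomogZ.
    by rewrite dhomogX /= mdeg_mset; case: (zP k) => ->.
  move=> m; rewrite mcoeff_msupp mcoeffB => nz; apply: contraT => mred.
  have [mj|mj] := eqVneq (mdeg m) j; last first.
    case/eqP: nz; rewrite (dhomog_nemf_coeff vj) // sub0r raddf_sum /= big1 ?oppr0 //.
    move=> k _; rewrite mcoeffZ mcoeffX; case: eqP; rewrite ?mulr0 // => e.
    by rewrite -e mdeg_mset in mj; case: (zP k) => kj; rewrite kj eqxx in mj.
  have [mD|mD] := boolP (msupport m \in D).
    case/eqP: nz; rewrite raddf_sum /= big1 ?subr0 => [|k _].
      by apply/eqP; rewrite mcoeff_eq0; apply/negP => /vD; rewrite mD.
    rewrite mcoeffZ mcoeffX; case: eqP; rewrite ?mulr0 // => e.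
    by rewrite -e msetK in mD; case: (zP k) => _ /negP[].
  have [min mE] := irreducible_minimal mD mred; rewrite mj in min.
  case/eqP: nz; rewrite mE -(enum_rankK_in min min) coef_z mxE.
  by rewrite subrr.
apply/rowP => k; rewrite mxE.
have := @boundary_reducible j _ a0 cb (mset (enum_val k)).
rewrite coef mcoeff_msupp mcoeffB coef_z; have [_ _ kmin] := zP k.
rewrite (negbTE (irreducible_mset kmin)) => nz.
by apply/eqP; rewrite -subr_eq0; apply/negPn/negP => /nz.
Qed.

End MinimalNonfaces.

(** * Combinatorial shifting *)

Section Shifting.
Set Implicit Arguments.
Unset Strict Implicit.
Unset Printing Implicit Defensive.
Variable n : nat.
Implicit Types (D : {set {set 'I_n}}) (s t : {set 'I_n}) (i j : 'I_n).

Definition exchange i j s : {set 'I_n} := j |: (s :\ i).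

Lemma exchangeK i j s : i \in s -> j \notin s ->
  exchange j i (exchange i j s) = s.
Proof.
move=> si sj; apply/setP => x; rewrite !inE.
have [->|xi] /= := eqVneq x i; first by rewrite si.
by have [->|xj] //= := eqVneq x j; rewrite (negbTE sj).
Qed.

Lemma card_exchange i j s : i \in s -> j \notin s -> #|exchange i j s| = #|s|.
Proof.
move=> si sj; rewrite cardsU1 !inE (negbTE sj) andbF.
by rewrite [RHS](cardsD1 i) si.
Qed.

(** Membership in a shifted family depends only on the membership of a set and
    of the set exchanged with it. The condition for the complements has the
    same form, so nonfaces can be followed instead of faces. *)
Lemma mem_Shift D i j s : i != j -> (s \in Shift i j D) =
  if (i \in s) && (j \notin s) then (s \in D) && (exchange i j s \in D)
  else if (j \in s) && (i \notin s) then (s \in D) || (exchange j i s \in D)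
  else s \in D.
Proof.
move=> ij; have shE t : shift_face D i j t =
    if [&& i \in t, j \notin t & exchange i j t \notin D] then exchange i j t else t.
  by [].
apply/imsetP/idP => [[t tD ->]|].
  rewrite shE.
  have [/and3P[it jt tD']|] := boolP [&& i \in t, j \notin t & exchange i j t \notin D].
    rewrite exchangeK // tD orbT {1 2 3 4}/exchange !inE !eqxx (negbTE ij) /=.
    by [].
  rewrite tD /= if_same; case: ifP => // /andP[-> ->] /=.
  by rewrite negbK.
case: ifPn => [/andP[si sj] /andP[sD sD']|nsi].
  by exists s; rewrite ?shE // sD' !andbF.
case: ifPn => [/andP[sj si]|nsj sD].
  have [sD _|sD /= sD'] := boolP (s \in D); first by exists s; rewrite ?shE // (negbTE si).
  exists (exchange j i s); rewrite ?shE // exchangeK // sD.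
  by rewrite /exchange !inE !eqxx [j == i]eq_sym (negbTE ij).
by exists s => //; rewrite shE andbA (negbTE nsi).
Qed.

(** Shifted complexes are the common fixed points of the shifts. *)
Lemma shiftedP D :
  shifted D <-> forall i j, (i < j)%N -> Shift i j D = D.
Proof.
split=> [sD i j ij|sD s i j Ds si ij sj].
  rewrite -[RHS]imset_id; apply: eq_in_imset => s Ds; rewrite /shift_face.
  by case: ifP => // /and3P[si sj]; rewrite (sD s i j).
have ne : i != j by apply: contraTneq ij => ->; rewrite ltnn.
by move: Ds; rewrite -{1}(sD i j ij) mem_Shift // si sj => /andP[].
Qed.

End Shifting.

(** * Monomials in ideals of the exterior algebra *)

Section FaceIdeal.
Set Implicit Arguments.
Unset Strict Implicit.
Unset Printing Implicit Defensive.
Import GRing.Theory.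
Local Open Scope ring_scope.
Variables (K : fieldType) (n : nat).
Implicit Types (G D : {set {set 'I_n}}) (s g : {set 'I_n}) (f : exterior K n).

(** The elements whose monomials all contain a generator form an ideal, so the
    ideal generated has no other monomial. *)
Lemma ext_ideal_genP G s :
  ext_ideal_gen G (ext_mon K s) <-> exists2 g, g \in G & g \subset s.
Proof.
split=> [sG|[g gG gs] J [_ _ Jl _] JG].
  (* This ideal of monomials above a generator bounds the generated one. *)
  pose J f := forall r : {set 'I_n}, f r != 0 -> exists2 g, g \in G & g \subset r.
  suff /(_ s) : J (ext_mon K s) by rewrite ffunE eqxx oner_neq0; apply.
  apply: sG => [|g gG r]; last first.
    by rewrite ffunE; have [-> _|_] := eqVneq r g; [exists g | rewrite eqxx].
  split=> [r|f f' Jf Jf' r|a f Jf r|a f Jf r]; rewrite ffunE ?eqxx //.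
  - have [f0|/Jf //] := eqVneq (f r) 0; rewrite f0 add0r; exact: Jf'.
  - move=> nz; have [t tr] : exists2 t : {set 'I_n}, t \subset r & f (r :\: t) != 0.
      apply/exists_inP; apply: contraR nz => /exists_inPn no.
      rewrite big1 // => t tr; have := no t tr.
      by rewrite negbK => /eqP ->; rewrite mulr0.
    by move=> /Jf[g gG gt]; exists g => //; apply: subset_trans gt (subsetDl _ _).
  - move=> nz; have [t tr] : exists2 t : {set 'I_n}, t \subset r & f t != 0.
      apply/exists_inP; apply: contraR nz => /exists_inPn no.
      rewrite big1 // => t tr; have := no t tr.
      by rewrite negbK => /eqP ->; rewrite mulr0 mul0r.
    by move=> /Jf[g gG gt]; exists g => //; apply: subset_trans gt tr.
(* The sign of e_(s - g) /\ e_g, which the left factor cancels. *)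
pose c : K := (-1) ^+ inversions (s :\: g) g.
have sgg : s :\: (s :\: g) = g by rewrite setDDr setDv set0U; apply/setIidPr.
have -> : ext_mon K s = wedge [ffun t => c * (t == s :\: g)%:R] (ext_mon K g).
  apply/ffunP => r; rewrite !ffunE.
  have [->|rs] := eqVneq r s.
    rewrite (bigD1 (s :\: g)) ?subsetDl //= big1 => [|t /andP[_ /negbTE tg]]; last first.
      by rewrite ffunE tg !mulr0 mul0r.
    by rewrite !ffunE sgg !eqxx !mulr1 addr0 -expr2 sqrr_sign.
  rewrite big1 // => t tr; rewrite !ffunE; case: eqP => [tE|]; rewrite ?mulr0 ?mul0r //.
  case: eqP => [rt|]; rewrite ?mulr0 //; case/eqP: rs.
  by rewrite -(setID r t) (setIidPr tr) rt tE setUC -[RHS](setID s g) (setIidPr gs).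
by apply: Jl; apply: JG.
Qed.

Lemma mem_complex_ideal G D : (forall s t : {set 'I_n}, s \in D -> t \subset s -> t \in D) ->
  (forall f, ext_ideal_gen G f <-> exterior_face_ideal D f) ->
  forall s, (s \notin D) <-> exists2 g, g \in G & g \subset s.
Proof.
move=> Ddown GD s; rewrite -ext_ideal_genP GD /exterior_face_ideal ext_ideal_genP.
split=> [sD|[g gD gs]]; first by exists s; rewrite ?inE.
by rewrite inE in gD; apply: contra gD => /Ddown; apply.
Qed.

End FaceIdeal.

(** * Lexicographic segments with a graph in each degree *)

Section LexComplexes.
Set Implicit Arguments.
Unset Strict Implicit.
Unset Printing Implicit Defensive.
Implicit Types (s t : {set 'I_15}) (x y : 'I_15) (d : nat) (m : seq bool).

Definition v12 : 'I_15 := @Ordinal 15 11 isT.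
Definition v13 : 'I_15 := @Ordinal 15 12 isT.
Definition v14 : 'I_15 := @Ordinal 15 13 isT.
Definition v15 : 'I_15 := @Ordinal 15 14 isT.

(** The part of a set in the vertices 12, ..., 15, as a vector of four bits.
    Graphs on these vertices are lists of such vectors, which makes the search
    of [reachable_check] a computation. *)
Definition tail s : seq bool := [:: v12 \in s; v13 \in s; v14 \in s; v15 \in s].

Lemma tail_vertex x : 11 <= x -> [\/ x = v12, x = v13, x = v14 | x = v15].
Proof.
case: x => x lt /= le.
have : x \in [:: 11; 12; 13; 14] by rewrite !inE; lia.
rewrite !inE => /or4P[] /eqP e; [apply: Or41 | apply: Or42 | apply: Or43 | apply: Or44];
  exact: val_inj.
Qed.

Lemma nth_tail s x : 11 <= x -> nth false (tail s) (x - 11) = (x \in s).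
Proof. by case/tail_vertex => ->. Qed.

Lemma mem_h d x : 3 <= d < 9 -> (x \in h (d - 2)) = (d - 3 <= x <= 2 * d - 6).
Proof.
case: d => [|[|[|[|[|[|[|[|[|d]]]]]]]]] //; case: x => x lt _ /=; rewrite inE /= !inE; lia.
Qed.

(** The set [s] meets {1, ..., 11} in [h (d - 2)]. *)
Definition eq_head d s := [forall y : 'I_15, (y < 11) ==> ((y \in s) == (y \in h (d - 2)))].

(** The first difference between [s] and [h (d - 2)] is in [s] and among
    {1, ..., 11}. For sets of size [d] this is membership in [T d]: see [mem_T]. *)
Definition lex_head d s := [exists x : 'I_15, [&& x < 11, x \in s, x \notin h (d - 2) &
  [forall y : 'I_15, (y < x) ==> ((y \in s) == (y \in h (d - 2)))]]].

Lemma eq_headP d s :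
  reflect (forall y, y < 11 -> (y \in s) = (y \in h (d - 2))) (eq_head d s).
Proof.
apply: (iffP forallP) => H y; first by move=> yl; move/implyP/(_ yl)/eqP: (H y).
by apply/implyP => yl; apply/eqP/H.
Qed.

Lemma lex_headP d s :
  reflect (exists x, [/\ x < 11, x \in s, x \notin h (d - 2) &
                      forall y, y < x -> (y \in s) = (y \in h (d - 2))])
          (lex_head d s).
Proof.
apply: (iffP existsP) => -[x].
  case/and4P=> xl xs xh /forallP H; exists x; split=> // y yx.
  by move/implyP/(_ yx)/eqP: (H y).
case=> xl xs xh H; exists x; rewrite xl xs xh.
by apply/forallP => y; apply/implyP => yx; apply/eqP/H.
Qed.

Lemma eq_head_ext d s t : (forall y, y < 11 -> (y \in s) = (y \in t)) ->
  eq_head d s = eq_head d t.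
Proof.
move=> st; apply: eq_forallb => y; case: ltnP => //= yl; by rewrite st.
Qed.

Lemma lex_head_ext d s t : (forall y, y < 11 -> (y \in s) = (y \in t)) ->
  lex_head d s = lex_head d t.
Proof.
move=> st; apply: eq_existsb => x; case: ltnP => //= xl; rewrite st //.
congr [&& _, _ & _]; apply: eq_forallb => y; case: ltnP => //= yx.
by rewrite st // (ltn_trans yx).
Qed.

Lemma eq_head_lex d s : eq_head d s -> lex_head d s = false.
Proof.
move/eq_headP => E; apply/lex_headP => -[x [xl xs xh _]].
by rewrite -E // xs in xh.
Qed.

Lemma lex_head_low d s x : 3 <= d < 9 -> x \in s -> x < d - 3 -> lex_head d s.
Proof.
move=> dP xs xd.
have [y /= ys ymin] := @arg_minnP _ x (mem s) (@nat_of_ord 15) xs.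
have yd : y < d - 3 by apply: leq_ltn_trans (ymin x xs) xd.
apply/lex_headP; exists y; split=> //; first by lia.
  by rewrite mem_h //; lia.
move=> z zy; rewrite mem_h //; have -> : (z \in s) = false; last by lia.
by apply/negP => /ymin; lia.
Qed.

(** Edges are given as vectors of four bits; a sequence of six graphs lists
    those of degrees 3, ..., 8. *)
Definition graph := seq (seq bool).
Definition graph_at (G : seq graph) d : graph := nth [::] G (d - 3).

(** A set of nonfaces of the shape of [Delta], with arbitrary graphs [G] in
    degrees 3 to 8. *)
Definition nonface (G : seq graph) s :=
  (9 <= #|s|) || (3 <= #|s|) && (lex_head #|s| s || eq_head #|s| s && (tail s \in graph_at G #|s|)).

Definition state_complex (G : seq graph) : {set {set 'I_15}} := [set s | ~~ nonface G s].

(** A nonface of size [d] comes no later than [h (d - 2)], whose least element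
    is [d - 2]. *)
Lemma nonface_low G s : nonface G s -> #|s| < 9 ->
  3 <= #|s| /\ exists2 x, x \in s & x <= #|s| - 3.
Proof.
rewrite /nonface => + s9; rewrite leqNgt s9 /= => /andP[s3 H]; split=> //.
set d := #|s| in s3 s9 H *.
have dP : 3 <= d < 9 by rewrite s3.
have lt15 : d - 3 < 15 by lia.
have kh : Ordinal lt15 \in h (d - 2) by rewrite mem_h //=; lia.
case/orP: H => [/lex_headP[x [xl xs xh E]]|/andP[/eq_headP E _]].
  have [xd|xd] := leqP x (d - 3); first by exists x.
  by exists (Ordinal lt15) => //; rewrite E.
by exists (Ordinal lt15) => //; rewrite E //=; lia.
Qed.

(** By [nonface_low] a larger set of size [e < 9] has an element below
    [e - 2 = min (h (e - 2))], hence lies in the segment of its size. *)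
Lemma nonface_up G s t : nonface G s -> s \subset t -> nonface G t.
Proof.
move=> Ns st; have [t9|t9] := leqP 9 #|t|; first by rewrite /nonface t9.
have := subset_leq_card st; rewrite leq_eqVlt => /orP[/eqP e|lt].
  by have /eqP <- : s == t; rewrite // eqEcard st e /=.
have [s3 [x xs xl]] := nonface_low Ns (ltn_trans lt t9).
have t3 : 3 <= #|t| by apply: leq_trans s3 (ltnW lt).
have tP : 3 <= #|t| < 9 by rewrite t3.
have xt : x < #|t| - 3 by apply: leq_ltn_trans xl _; rewrite ltn_sub2r // (leq_ltn_trans s3).
by rewrite /nonface t3 (lex_head_low tP (subsetP st x xs) xt) orbT.
Qed.

Lemma state_complex_down G s t : s \in state_complex G -> t \subset s -> t \in state_complex G.
Proof. by rewrite !inE => Ns ts; apply: contra Ns => Nt; apply: nonface_up ts. Qed.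

Lemma card_head_tail d s : 3 <= d < 9 -> eq_head d s ->
  #|s| = (d - 2 + count id (tail s)).
Proof.
move=> dP /eq_headP E; rewrite -sum1_card big_mkcond /=.
rewrite (@big_split_ord _ _ _ 11 4) /=; congr (_ + _).
  under eq_bigr => x _ do rewrite E /= ?ltn_ord // mem_h //=.
  case: d dP {E} => [|[|[|[|[|[|[|[|[|d]]]]]]]]] // _; by rewrite !big_ord_recl big_ord0.
have vE x y : val x = val y -> (if x \in s then 1 else 0) = (y \in s) :> nat.
  by move=> /val_inj ->; case: (y \in s).
by rewrite !big_ord_recl big_ord0 /= (vE _ v12) // (vE _ v13) // (vE _ v14) // (vE _ v15).
Qed.

(** The six edges on the vertices 12, ..., 15. *)
Definition masks : seq (seq bool) :=
  [:: [:: true; true; false; false]; [:: true; false; true; false];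
      [:: true; false; false; true]; [:: false; true; true; false];
      [:: false; true; false; true]; [:: false; false; true; true]].

Definition tail_set m : {set 'I_15} := [set x : 'I_15 | (11 <= x) && nth false m (x - 11)].

Definition set_of_tail d m : {set 'I_15} := h (d - 2) :|: tail_set m.

Lemma eq_head_mk d m : eq_head d (set_of_tail d m).
Proof.
apply/eq_headP => y yl; rewrite !inE [11 <= y]leqNgt yl /=; exact: orbF.
Qed.

Lemma h_low d x : 3 <= d < 9 -> 11 <= x -> (x \in h (d - 2)) = false.
Proof. by move=> dP xl; rewrite mem_h //; lia. Qed.

Lemma tail_mk d m : 3 <= d < 9 -> size m = 4 -> tail (set_of_tail d m) = m.
Proof.
move=> dP m4; rewrite /tail !inE !h_low //=.
by case: m m4 => [|a [|b [|c [|e []]]]].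
Qed.

Lemma head_tail_inj d s t : eq_head d s -> eq_head d t -> tail s = tail t -> s = t.
Proof.
move=> /eq_headP Es /eq_headP Et st; apply/setP => x.
have [xl|xl] := ltnP x 11; first by rewrite Es ?Et.
by rewrite -(nth_tail s) // -(nth_tail t) // st.
Qed.

Lemma mk_tail d s : 3 <= d < 9 -> eq_head d s -> s = set_of_tail d (tail s).
Proof.
by move=> dP Es; apply: head_tail_inj Es (eq_head_mk d _) _; rewrite tail_mk.
Qed.

Lemma card_mk d m : 3 <= d < 9 -> size m = 4 -> #|set_of_tail d m| = d - 2 + count id m.
Proof.
by move=> dP m4; rewrite (card_head_tail dP (eq_head_mk d m)) tail_mk.
Qed.

Lemma masks_size m : m \in masks -> size m = 4.
Proof. by move=> mm; apply/eqP; move: m mm; apply/allP. Qed.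

Lemma masks_count m : m \in masks -> count id m = 2.
Proof. by move=> mm; apply/eqP; move: m mm; apply/allP. Qed.

Lemma tail_mask d s : 3 <= d < 9 -> #|s| = d -> eq_head d s -> tail s \in masks.
Proof.
move=> dP sd Es; have := card_head_tail dP Es; rewrite sd => e.
have {e} : count id (tail s) = 2 by lia.
rewrite /tail; do 4 case: (_ \in s) => //.
Qed.

Lemma card_mk_mask d m : 3 <= d < 9 -> m \in masks -> #|set_of_tail d m| = d.
Proof. by move=> dP mm; rewrite card_mk ?masks_size ?masks_count //; lia. Qed.

Lemma nonface_mk G d m : 3 <= d < 9 -> m \in masks ->
  nonface G (set_of_tail d m) = (m \in graph_at G d).
Proof.
move=> dP mm; rewrite /nonface card_mk_mask // (eq_head_lex (eq_head_mk d m)).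
by rewrite eq_head_mk tail_mk ?masks_size //= leqNgt; case/andP: dP => -> ->.
Qed.

Definition graphs0 : seq graph :=
  [:: [:: [:: true; true; false; false]; [:: true; false; false; true];
          [:: false; true; true; false]];
      [:: [:: true; true; false; false]; [:: true; false; true; false];
          [:: false; false; true; true]];
      [:: [:: true; true; false; false]; [:: true; false; false; true];
          [:: false; false; true; true]];
      [:: [:: true; true; false; false]; [:: false; true; true; false];
          [:: false; false; true; true]];
      [:: [:: true; true; false; false]; [:: false; true; false; true];
          [:: false; false; true; true]];
      [:: [:: true; false; true; false]; [:: false; true; false; true];
          [:: false; false; true; true]]].

Lemma vset_tail l : all (leq 12) l ->
  vset l = tail_set [:: 12 \in l; 13 \in l; 14 \in l; 15 \in l].
Proof.
move=> l12; apply/setP => x; rewrite !inE; have [xl|xl] := leqP 11 x.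
  by case/tail_vertex: xl => ->.
by apply/negbTE/negP => /(allP l12) /=; rewrite ltnS leqNgt xl.
Qed.

Lemma graphs0_masks d : {subset graph_at graphs0 d <= masks}.
Proof.
rewrite /graph_at; case: (ltnP (d - 3) (size graphs0)) => dl; last by rewrite nth_default.
have : all (fun g => all (mem masks) g) graphs0 by vm_compute.
by move/(all_nthP [::])/(_ _ dl)/allP.
Qed.

Lemma mem_HP d e : 3 <= d < 9 ->
  reflect (exists2 m, m \in graph_at graphs0 d & e = tail_set m) (e \in H d).
Proof.
move=> dP; suff -> : H d = [set e | e \in map tail_set (graph_at graphs0 d)].
  by rewrite inE; exact: mapP.
apply/setP => t; rewrite inE.
by case: d dP => [|[|[|[|[|[|[|[|[|d]]]]]]]]] // _; rewrite /= !vset_tail // !inE -orbA.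
Qed.

Lemma mem_TH d s : 3 <= d < 9 ->
  (s \in TH d) = [&& #|s| == d, eq_head d s & tail s \in graph_at graphs0 d].
Proof.
move=> dP; apply/imsetP/and3P => [[e /(mem_HP _ dP)[m mG ->] ->]|[/eqP sd Es tG]].
  rewrite -/(set_of_tail d m) card_mk_mask ?(graphs0_masks mG) // eq_head_mk.
  by rewrite tail_mk // masks_size ?(graphs0_masks mG).
exists (tail_set (tail s)); first by apply/mem_HP => //; exists (tail s).
exact: mk_tail.
Qed.

(** A set that first differs from [h (d - 2) :|: {12, 13}] beyond 13 would
    contain it strictly and have too many elements. *)
Lemma mem_T d s : 3 <= d < 9 -> (s \in T d) = (#|s| == d) && lex_head d s.
Proof.
move=> dP; rewrite inE; case: eqP => //= sd.
have inr x : (x \in h (d - 2) :|: vset [:: 12; 13]) =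
    (x \in h (d - 2)) || (x == v12) || (x == v13).
  by rewrite !inE orbA; congr (_ || _ || _); apply/eqP/eqP => [[e]|->] //; apply: val_inj.
apply/existsP/lex_headP => -[x].
  case/andP; rewrite in_setD inr !negb_or -!andbA => /and4P[xh x12 x13 xs] /forallP E.
  have {}E y : y < x -> (y \in s) = (y \in h (d - 2)) || (y == v12) || (y == v13).
    by move=> yx; rewrite -inr; apply/eqP; move/implyP: (E y); apply.
  have xl : x < 11.
    rewrite ltnNge; apply/negP => xl; have {}xl : 12 < x.
      by case/tail_vertex: xl x12 x13 => ->.
    have Es : eq_head d s.
      apply/eq_headP => y yl; rewrite E; last by lia.
      by rewrite -orbA; case: eqP yl => [->|_] //; case: eqP => [->|_]; rewrite ?orbF.
    have := card_head_tail dP Es; rewrite sd.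
    have s12 : v12 \in s by rewrite E ?eqxx ?orbT // (ltn_trans _ xl).
    have s13 : v13 \in s by rewrite E ?eqxx ?orbT.
    rewrite /tail s12 s13; have := tail_vertex (ltnW (ltnW xl)).
    case=> xE; move: xl xs; rewrite xE // => _ -> /=.
      by case: (v15 \in s) => /=; lia.
    by case: (v14 \in s) => /=; lia.
  exists x; split=> // y yx; rewrite E //.
  have [e1 e2] : (y == v12) = false /\ (y == v13) = false.
    by split; apply/negbTE; apply: contraTneq yx => -> /=; lia.
  by rewrite e1 e2 !orbF.
case=> xl xs xh E; exists x; rewrite in_setD inr !negb_or xs xh /=.
have N y : y < 11 -> (y == v12) = false /\ (y == v13) = false.
  by move=> yl; split; apply/negbTE; apply: contraTneq yl => ->.
have [-> ->] := N x xl; apply/forallP => y; apply/implyP => yx.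
by have [e1 e2] := N y (ltn_trans yx xl); rewrite inr e1 e2 !orbF E.
Qed.

Lemma generatorsP s : s \in generators <->
  #|s| = 9 \/ exists2 d, 3 <= d < 9 & (s \in T d) || (s \in TH d).
Proof.
have -> : (s \in generators) = has (fun d => s \in T d :|: TH d) (index_iota 3 9) || (#|s| == 9).
  rewrite inE inE; congr (_ || _); elim: (index_iota 3 9) => [|d r IH].
    by rewrite big_nil inE.
  by rewrite big_cons in_setU IH.
split=> [/orP[/hasP[d]|/eqP]|[->|[d dP sT]]]; rewrite ?eqxx ?orbT //.
- by rewrite mem_index_iota in_setU => dP sT; right; exists d.
- by left.
- by apply/orP; left; apply/hasP; exists d; rewrite ?mem_index_iota // in_setU.
Qed.

(** The generators are the nonfaces of sizes 3 to 9; as nonfaces are closed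
    under taking supersets, there are no others of these sizes in the ideal. *)
Lemma nonface_graphs0 s :
  (exists2 g, g \in generators & g \subset s) <-> nonface graphs0 s.
Proof.
split=> [[g /generatorsP gG]|Ns].
  apply: nonface_up; rewrite /nonface; case: gG => [-> //|[d dP]].
  rewrite mem_T // mem_TH // -andb_orr => /andP[/eqP -> ->].
  by case/andP: dP => ->; rewrite orbT.
have [s9|s9] := leqP 9 #|s|.
  have : 0 < #|[set g : {set 'I_15} | g \subset s & #|g| == 9]|.
    by rewrite cards_draws bin_gt0.
  rewrite card_gt0 => /set0Pn[g]; rewrite inE => /andP[gs /eqP g9].
  by exists g => //; apply/generatorsP; left.
exists s => //; apply/generatorsP; right; exists #|s|.
  by case: (nonface_low Ns s9) => ->; rewrite s9.
move: Ns; rewrite /nonface leqNgt s9 /= => /andP[s3 Ns].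
by rewrite mem_T ?s3 // mem_TH ?s3 // eqxx.
Qed.

End LexComplexes.

(** * Shifting acts on the graphs *)

Section ShiftAction.
Set Implicit Arguments.
Unset Strict Implicit.
Unset Printing Implicit Defensive.
Implicit Types (s t : {set 'I_15}) (x y i j : 'I_15) (d a b : nat) (m : seq bool)
  (G : seq graph) (g : graph).

(** Putting [i <= 11] in place of a larger element makes a nonface
    larger in the lexicographic order, with the first difference from
    [h (d - 2)] still at 11 or before. *)
Lemma nonface_exchange_head G i j s : i < 11 -> i < j -> j \in s -> i \notin s ->
  nonface G s -> nonface G (exchange j i s).
Proof.
move=> i11 ij js si; rewrite /nonface card_exchange //.
case: (9 <= #|s|) => //=; case s3: (3 <= #|s|) => //=.
set d := #|s| => H; suff -> : lex_head d (exchange j i s) by [].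
have low y : y < i -> (y \in exchange j i s) = (y \in s).
  move=> yi; rewrite !inE; have [e|_] := eqVneq y i; first by rewrite e ltnn in yi.
  by have [e|] := eqVneq y j; first by rewrite e ltnNge ltnW in yi.
have is' : i \in exchange j i s by rewrite !inE eqxx.
case/orP: H => [/lex_headP[x [xl xs xh E]]|/andP[/eq_headP E _]]; apply/lex_headP.
  have [xi|ix] := ltnP x i.
    exists x; split=> //; rewrite ?low // => y yx.
    by rewrite low ?E // (ltn_trans yx).
  have {}ix : i < x.
    by rewrite ltn_neqAle ix andbT; apply: contraNneq si => /val_inj ->.
  exists i; split=> // [|y yi]; first by rewrite -E.
  by rewrite low // E // (ltn_trans yi).
exists i; split=> // [|y yi]; first by rewrite -E.
by rewrite low // E // (ltn_trans yi).
Qed.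

Definition swap_mask a b m : seq bool :=
  set_nth false (set_nth false m a (nth false m b)) b (nth false m a).

Lemma tail_exchange i j s t : 11 <= i -> i < j ->
  (forall x, x != i -> x != j -> (x \in t) = (x \in s)) ->
  (i \in t) = (j \in s) -> (j \in t) = (i \in s) ->
  tail t = swap_mask (i - 11) (j - 11) (tail s).
Proof.
move=> il ij E ti tj; have jl : 11 <= j by lia.
rewrite /tail; move: ij E ti tj.
by case/tail_vertex: il => ->; case/tail_vertex: jl => -> //= _ E -> ->; rewrite !E.
Qed.

(** Edges are nonfaces, so they move in the direction opposite to faces: from
    [b] to [a], for [a < b] counted from the vertex 12. *)
Definition shift_graph a b g : graph :=
  [seq m <- masks |
    if nth false m a && ~~ nth false m b then (m \in g) || (swap_mask a b m \in g)
    else if nth false m b && ~~ nth false m a then (m \in g) && (swap_mask a b m \in g)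
    else m \in g].

Definition shift_state a b G := map (shift_graph a b) G.

Lemma graph_at_shift a b G d : graph_at (shift_state a b G) d = shift_graph a b (graph_at G d).
Proof.
rewrite /graph_at; case: (ltnP (d - 3) (size G)) => dl; first by rewrite (nth_map [::]).
rewrite !nth_default ?size_map // /shift_graph -(filter_pred0 masks).
by apply: eq_filter => m /=; rewrite !if_same.
Qed.

(** Exchanging two vertices after 11 leaves the comparison with
    [h (d - 2)] unchanged. *)
Lemma nonface_exchange_tail G i j s t : 11 <= i -> i < j ->
  (forall x, x != i -> x != j -> (x \in t) = (x \in s)) ->
  (i \in t) = (j \in s) -> (j \in t) = (i \in s) -> #|t| = #|s| ->
  nonface G t = (9 <= #|s|) || (3 <= #|s|) && (lex_head #|s| s ||
    eq_head #|s| s && (swap_mask (i - 11) (j - 11) (tail s) \in graph_at G #|s|)).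
Proof.
move=> il ij E ti tj ts.
have E' x : x < 11 -> (x \in t) = (x \in s).
  by move=> xl; apply: E; apply: contraTneq xl => ->; lia.
rewrite /nonface ts (tail_exchange il ij E ti tj).
by rewrite (lex_head_ext _ E') (eq_head_ext _ E').
Qed.

Lemma Shift_tail G i j : 11 <= i -> i < j ->
  Shift i j (state_complex G) = state_complex (shift_state (i - 11) (j - 11) G).
Proof.
move=> il ij; have jl : 11 <= j by lia.
have ne : i != j by apply: contraTneq ij => ->; rewrite ltnn.
apply/setP => s; rewrite mem_Shift // !inE [nonface G s]/nonface [in RHS]/nonface graph_at_shift.
have [s9|s9] /= := leqP 9 #|s|.
  case: ifP => // [_]; case: ifP => // /andP[js si].
  by rewrite /nonface card_exchange // s9.
have [s3|] /= := leqP 3 #|s|; last first.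
  move=> s3; case: ifP => // [/andP[is' js]|_]; last by case: ifP.
  by rewrite /nonface card_exchange // leqNgt s9 leqNgt s3.
have dP : 3 <= #|s| < 9 by rewrite s3.
have xtail e : e = (if (i \in s) && (j \notin s) then exchange i j s else exchange j i s) ->
   (i \in s) != (j \in s) ->
   nonface G e = lex_head #|s| s || eq_head #|s| s &&
     (swap_mask (i - 11) (j - 11) (tail s) \in graph_at G #|s|).
  move=> eE ijs; rewrite (@nonface_exchange_tail G i j s e) //.
  - by rewrite leqNgt s9 s3.
  - by move=> x xi xj; rewrite eE; case: ifP => _; rewrite !inE (negbTE xi) (negbTE xj).
  - rewrite eE; case: ifP ijs; rewrite !inE !eqxx ?(negbTE ne).
      by case/andP=> -> /negbTE ->.
    by case: (i \in s); case: (j \in s).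
  - rewrite eE; case: ifP ijs; rewrite !inE !eqxx ?[j == i]eq_sym ?(negbTE ne).
      by case/andP=> -> /negbTE ->.
    by case: (i \in s); case: (j \in s).
  - rewrite eE; case: ifP => [/andP[is' js]|]; first by rewrite card_exchange.
    move=> H; rewrite card_exchange //; move: H ijs;
    by case: (i \in s); case: (j \in s).
case Ls: (lex_head _ _) xtail => //= xtail.
  case: ifP => // H1; case: ifP => // H.
  by rewrite (xtail _) ?H1 //; case/andP: H => -> /negbTE ->.
case Es: (eq_head _ _) xtail => //= xtail; last first.
  case: ifP => [H|_]; last by case: ifP.
  by rewrite (xtail _) ?H //; case/andP: H => -> /negbTE ->.
rewrite mem_filter (tail_mask dP) // andbT !nth_tail //.
case: ifP => [H|H1]; last case: ifP => [H|//].
  by rewrite (xtail _) ?H //; [rewrite negb_or | case/andP: H => -> /negbTE ->].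
by rewrite (xtail _) ?H1 //; [rewrite negb_and | case/andP: H => -> /negbTE ->].
Qed.

Lemma Shift_head G i j : i < 11 -> i < j -> Shift i j (state_complex G) = state_complex G.
Proof.
move=> il ij; have ne : i != j by apply: contraTneq ij => ->; rewrite ltnn.
apply/setP => s; rewrite mem_Shift // !inE; case: ifP => [/andP[is' js]|_].
  case Ns: (nonface G s) => //=; apply: contraFN Ns => N.
  rewrite -(exchangeK is' js); apply: nonface_exchange_head N => //.
    by rewrite !inE eqxx.
  by rewrite !inE eqxx (negbTE ne).
case: ifP => // /andP[js si]; case Ns: (nonface G s) => //=.
by rewrite (nonface_exchange_head il ij js si Ns).
Qed.

Definition moves : seq (nat * nat) :=
  [:: (0, 1); (0, 2); (0, 3); (1, 2); (1, 3); (2, 3)].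

Definition successors G := [seq shift_state ab.1 ab.2 G | ab <- moves].

(** The states met from the initial one. Eight rounds suffice;
    [reachable_check] tests that the result is closed under the six shifts. *)
Definition reachable : seq (seq graph) :=
  iter 8 (fun R => undup (R ++ flatten (map successors R))) [:: graphs0].

Definition star : graph :=
  [:: [:: true; true; false; false]; [:: true; false; true; false];
      [:: true; false; false; true]].

Definition triangle : graph :=
  [:: [:: true; true; false; false]; [:: true; false; true; false];
      [:: false; true; true; false]].

Definition stable G := all (fun ab => shift_state ab.1 ab.2 G == G) moves.

(** Graphs listed in the order of [masks], so that states can be compared by
    the complexes that they define. *)
Definition normal G :=
  (size G == 6) && all (fun g => g == [seq m <- masks | m \in g]) G.

Definition star_or_triangle G := all (fun g => (g == star) || (g == triangle)) G && (size G == 6).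

(** The finite search: among the reachable states, those that are fixed by all
    shifts consist of stars and triangles, with at least one of each. *)
Lemma reachable_check :
  [&& graphs0 \in reachable,
      all (fun G => all (fun G' => G' \in reachable) (successors G)) reachable,
      all normal reachable &
      all (fun G => stable G ==> [&& star_or_triangle G, star \in G & triangle \in G]) reachable].
Proof. by vm_compute. Qed.

End ShiftAction.

(** * Reachable shifted complexes and their minimal nonfaces *)

Section ShiftedStates.
Set Implicit Arguments.
Unset Strict Implicit.
Unset Printing Implicit Defensive.
Implicit Types (s t : {set 'I_15}) (x y i j : 'I_15) (d a b e : nat) (m : seq bool)
  (G : seq graph) (g : graph).

(* Keeps unification from evaluating the search. *)
Opaque reachable.

Lemma reachable_graphs0 : graphs0 \in reachable.
Proof. by have /and4P[] := reachable_check. Qed.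

Lemma reachable_normal G : G \in reachable -> normal G.
Proof. by have /and4P[_ _ /allP H _] := reachable_check; apply: H. Qed.

Lemma reachable_stable G : G \in reachable -> stable G ->
  [&& star_or_triangle G, star \in G & triangle \in G].
Proof. by have /and4P[_ _ _ /allP H] := reachable_check; move/H/implyP; apply. Qed.

Lemma reachable_successor G G' :
  G \in reachable -> G' \in successors G -> G' \in reachable.
Proof.
move=> GR GG'; have /and4P[_ /allP H _ _] := reachable_check.
exact: (allP (H G GR)) G' GG'.
Qed.

Lemma mem_moves i j : 11 <= i -> i < j -> (i - 11, j - 11) \in moves.
Proof.
move=> il ij; have jl := leq_trans il (ltnW ij); move: ij.
by case/tail_vertex: il => ->; case/tail_vertex: jl => ->.
Qed.

Lemma movesP ab : ab \in moves ->
  exists i j, [/\ 11 <= i, i < j & ab = (i - 11, j - 11)].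
Proof.
rewrite !inE; case/predU1P => [->|]; first by exists v12, v13.
case/predU1P => [->|]; first by exists v12, v14.
case/predU1P => [->|]; first by exists v12, v15.
case/predU1P => [->|]; first by exists v13, v14.
case/predU1P => [->|/eqP ->]; first by exists v13, v15.
by exists v14, v15.
Qed.

Lemma reachable_Shift G i j : G \in reachable -> i < j ->
  exists2 G', G' \in reachable & Shift i j (state_complex G) = state_complex G'.
Proof.
move=> GR ij; have [il|il] := leqP 11 i; last by exists G; [exact: GR | exact: Shift_head].
exists (shift_state (i - 11) (j - 11) G); last exact: Shift_tail.
apply: reachable_successor GR _; apply/mapP.
by exists (i - 11, j - 11); first exact: mem_moves.
Qed.

Lemma reachable_foldl (p : seq ('I_15 * 'I_15)) G : G \in reachable ->
  all (fun ij : 'I_15 * 'I_15 => ij.1 < ij.2) p ->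
  exists2 G', G' \in reachable &
    foldl (fun X (ij : 'I_15 * 'I_15) => Shift ij.1 ij.2 X) (state_complex G) p = state_complex G'.
Proof.
elim: p G => [|[i j] p IH] G GR /=; first by exists G.
case/andP=> ij pp; have [G' GR' ->] := reachable_Shift GR ij.
exact: IH.
Qed.

Lemma graph_at_normal G d : normal G -> graph_at G d = [seq m <- masks | m \in graph_at G d].
Proof.
rewrite /graph_at; case/andP => _ GN; case: (ltnP (d - 3) (size G)) => dl.
  exact/eqP/(all_nthP [::] GN).
by rewrite nth_default.
Qed.

Lemma state_complex_inj G G' : normal G -> normal G' ->
  state_complex G = state_complex G' -> G = G'.
Proof.
move=> GN GN' e; have /andP[/eqP s6 _] := GN; have /andP[/eqP s6' _] := GN'.
apply: (@eq_from_nth _ [::]); first by rewrite s6.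
move=> k; rewrite s6 => k6; have dP : 3 <= k + 3 < 9 by lia.
have := graph_at_normal (k + 3) GN; have := graph_at_normal (k + 3) GN'.
rewrite /graph_at !addnK => -> ->; apply: eq_in_filter => m mm.
have := nonface_mk G dP mm; have := nonface_mk G' dP mm.
rewrite /graph_at !addnK => <- <-; apply/negb_inj.
by have := congr1 (fun X : {set {set 'I_15}} => set_of_tail (k + 3) m \in X) e; rewrite !inE.
Qed.

Lemma shifted_stable G : G \in reachable -> shifted (state_complex G) -> stable G.
Proof.
move=> GR /shiftedP sh; apply/allP => ab abm; have [i [j [il ij abE]]] := movesP abm.
rewrite abE /=; apply/eqP/state_complex_inj; last by rewrite -(Shift_tail _ il ij) sh.
  apply/reachable_normal/(reachable_successor GR)/mapP.
  by exists ab; [exact: abm | rewrite abE].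
exact: reachable_normal.
Qed.

Lemma stable_shifted G : stable G -> shifted (state_complex G).
Proof.
move=> /allP st; apply/shiftedP => i j ij.
have [il|il] := leqP 11 i; last exact: Shift_head.
by rewrite (Shift_tail _ il ij); have /eqP -> := st _ (mem_moves il ij).
Qed.

Local Notation mnf G e := (minimal_nonfaces (state_complex G) e).

Lemma mem_mnf G e s : (s \in mnf G e) =
  [&& #|s| == e, nonface G s & [forall x in s, ~~ nonface G (s :\ x)]].
Proof.
rewrite !inE negbK; congr [&& _, _ & _]; apply: eq_forallb => x.
by rewrite inE.
Qed.

Lemma star_or_triangle_at G d : star_or_triangle G -> 3 <= d < 9 ->
  graph_at G d = star \/ graph_at G d = triangle.
Proof.
case/andP=> GA /eqP s6 dP; have dl : d - 3 < size G by lia.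
by have /orP[/eqP|/eqP] := all_nthP [::] GA _ dl; [left | right].
Qed.

Lemma star_or_triangle_masks G d : star_or_triangle G -> 3 <= d < 9 ->
  [/\ {subset graph_at G d <= masks}, uniq (graph_at G d) & size (graph_at G d) = 3].
Proof.
by move=> GA dP; case: (star_or_triangle_at GA dP) => ->; split=> //; apply/allP.
Qed.

(** The sets of size [e] outside the segment, when applied to nonfaces of
    size [e]; none for [e = 9], where every set is a nonface. *)
Definition equal_head e : {set {set 'I_15}} := [set s | (e < 9) && eq_head e s].

(** The edge sets [h (d - 1) :|: {a, b}] are all minimal nonfaces, because
    their subsets of size [d] start too late; each graph has three edges. *)
Lemma card_mnf_equal_head G d : star_or_triangle G -> 3 <= d < 9 ->
  #|mnf G d.+1 :&: equal_head d.+1| = if d.+1 < 9 then 3 else 0.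
Proof.
move=> GA dP; case: ifPn => d9; last first.
  by apply/eqP; rewrite cards_eq0; apply/eqP/setP => s; rewrite !inE (negbTE d9) andbF.
have d1P : 3 <= d.+1 < 9 by rewrite d9 ltnW //; case/andP: dP.
have [Gm Gu Gs] := star_or_triangle_masks GA d1P.
transitivity (size [seq set_of_tail d.+1 m | m <- graph_at G d.+1]); last by rewrite size_map.
set r := map _ _.
have ru : uniq r.
  rewrite map_inj_in_uniq // => m m' /Gm mm /Gm mm' e.
  by rewrite -(tail_mk d1P (masks_size mm)) e tail_mk // masks_size.
rewrite -(card_uniqP ru); apply: eq_card => s.
rewrite in_setI mem_mnf [s \in equal_head _]inE d9 /=.
apply/andP/mapP => [[/and3P[/eqP sd Ns _] Es]|[m mG ->]].
  exists (tail s); last exact: mk_tail.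
  by move: Ns; rewrite /nonface sd leqNgt d9 (eq_head_lex Es) Es /= => /andP[].
have mm := Gm m mG; rewrite card_mk_mask // nonface_mk // mG eqxx eq_head_mk.
split=> //=; apply/forall_inP => x xs; apply/negP => N.
have cd : #|set_of_tail d.+1 m :\ x| = d.
  by have := cardsD1 x (set_of_tail d.+1 m); rewrite xs card_mk_mask // add1n => -[].
have [|_ [y]] := nonface_low N; first by rewrite cd; case/andP: dP.
rewrite cd => /setD1P[_ ys] yd.
have yl : y < 11 by lia.
move: ys; rewrite (eq_headP _ _ (eq_head_mk d.+1 m)) // mem_h //; lia.
Qed.

Lemma card_setD1 s x d : x \in s -> #|s| = d.+1 -> #|s :\ x| = d.
Proof. by move=> xs sd; have := cardsD1 x s; rewrite xs sd add1n => -[]. Qed.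

Lemma nonfaceE G s d : #|s| = d -> 3 <= d < 9 ->
  nonface G s = lex_head d s || eq_head d s && (tail s \in graph_at G d).
Proof. by move=> sd /andP[d3 d9]; rewrite /nonface sd leqNgt d9 d3. Qed.

Lemma head_setD1 s x y : 11 <= x -> y < 11 -> (y \in s :\ x) = (y \in s).
Proof.
by move=> xl yl; rewrite !inE; case: eqP => // e; move: yl; rewrite e ltnNge xl.
Qed.

Lemma eq_head_setD1 s x d : x \in s -> 11 <= x -> eq_head d (s :\ x) = eq_head d s.
Proof. by move=> xs xl; apply: eq_head_ext => y; apply: head_setD1. Qed.

(** A set of size [d + 1] above an edge of the star is above a nonface of the
    triangle. If it has a vertex at 11 or before outside [h (d - 2)], removing
    a vertex after 11 leads into the segment; otherwise it is [h (d - 2)] with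
    a triple, and every triple contains an edge of the triangle. *)
Lemma triangle_covers G d s x : 3 <= d < 9 -> #|s| = d.+1 -> x \in s ->
  graph_at G d = triangle -> eq_head d (s :\ x) -> tail (s :\ x) \in star ->
  exists2 y, y \in s & nonface G (s :\ y).
Proof.
move=> dP sd xs GT Es tS; have tm : tail (s :\ x) \in masks.
  by apply: (tail_mask dP) => //; apply: card_setD1.
have [xl|xl] := leqP 11 x; last first.
  have [y ys yl] : exists2 y, y \in s & 11 <= y.
    move: tS; rewrite /tail !inE; have [s12 _|s12] := boolP (v12 \in s); last by rewrite !andbF.
    by exists v12.
  exists y => //; rewrite (nonfaceE _ (card_setD1 ys sd) dP); apply/orP; left.
  apply/lex_headP; exists x; split=> //; first by rewrite head_setD1.
    by rewrite -(eq_headP _ _ Es) // !inE eqxx.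
  move=> z zx; have zl := ltn_trans zx xl.
  rewrite head_setD1 // -(eq_headP _ _ Es) // !inE.
  by have [e|] := eqVneq z x; first by rewrite e ltnn in zx.
have Es' y : y \in s -> 11 <= y -> tail (s :\ y) \in triangle -> nonface G (s :\ y).
  move=> ys yl yT; rewrite (nonfaceE _ (card_setD1 ys sd) dP) GT yT andbT.
  by rewrite (eq_head_setD1 _ ys yl) -(eq_head_setD1 _ xs xl) Es orbT.
have H y : y \in s -> 11 <= y -> tail (s :\ y) \in triangle ->
    exists2 y, y \in s & nonface G (s :\ y).
  by move=> ys yl yT; exists y => //; apply: Es'.
move: xs tS; rewrite /tail /star !inE.
case/tail_vertex: xl => -> /=; case s12: (v12 \in s) => //=;
  case s13: (v13 \in s) => //=; case s14: (v14 \in s) => //=;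
  case s15: (v15 \in s) => //= _ tS; try by vm_compute in tS.
all: try by apply: (H v15); rewrite // /tail !inE ?s12 ?s13 ?s14 ?s15.
all: by apply: (H v14); rewrite // /tail !inE ?s12 ?s13 ?s14 ?s15.
Qed.

(** The triple 13, 14, 15 contains no edge of the star of 12. *)
Lemma mnf_tail_triple G d : 3 <= d < 9 -> graph_at G d = star ->
  set_of_tail d [:: false; true; true; true] \in mnf G d.+1 :\: equal_head d.+1.
Proof.
move=> dP GS; set m := [:: _; _; _; _]; set s := set_of_tail d m.
have sd : #|s| = d.+1 by rewrite card_mk //=; lia.
have ks : exists2 x, x \in s & x < d.+1 - 3.
  have lt15 : d - 3 < 15 by lia.
  by exists (Ordinal lt15); rewrite ?inE ?mem_h //=; lia.
rewrite in_setD mem_mnf sd eqxx /= inE negb_and -leqNgt; apply/and3P; split.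
- have [//|d9] := leqP 9 d.+1; apply/negP => Es.
  have d1P : 3 <= d.+1 < 9 by rewrite d9 ltnW //; case/andP: dP.
  case: ks => x xs xd; have := eq_head_lex Es.
  by rewrite (lex_head_low d1P xs xd).
- rewrite /nonface sd; have [//|d9] := leqP 9 d.+1.
  have d1P : 3 <= d.+1 < 9 by rewrite d9 ltnW //; case/andP: dP.
  case: ks => x xs xd; rewrite (lex_head_low d1P xs xd) /= andbT.
  by case/andP: d1P.
apply/forall_inP => x xs; rewrite (nonfaceE _ (card_setD1 xs sd) dP) GS negb_or.
have E := eq_headP _ _ (eq_head_mk d m).
apply/andP; split.
  apply/lex_headP => -[y [yl /setD1P[_ ys] yh _]].
  by rewrite -E // ys in yh.
have T12 : (v12 \in s) = false by rewrite /s !inE h_low.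
rewrite negb_and; apply/orP; right; rewrite /tail !in_setD1 T12 andbF.
by case: (_ && _); case: (_ && _); case: (_ && _).
Qed.

(** The minimal nonfaces outside the segment are equally many on both sides;
    those in the segment are strictly fewer for the triangle, by
    [triangle_covers] and the triple 13, 14, 15. *)
Lemma mnf_star_triangle G G' d : star_or_triangle G -> star_or_triangle G' -> 3 <= d < 9 ->
  graph_at G d = star -> graph_at G' d = triangle -> #|mnf G' d.+1| < #|mnf G d.+1|.
Proof.
move=> GA GA' dP GS GT; rewrite -(cardsID (equal_head d.+1)).
rewrite -[X in _ < X](cardsID (equal_head d.+1)).
rewrite !card_mnf_equal_head // ltn_add2l; apply/proper_card/properP; split.
  apply/subsetP => s; rewrite !in_setD => /andP[sb]; rewrite !mem_mnf sb /=.
  case/and3P=> /eqP sd Ns /forall_inP smin; rewrite sd eqxx /=; apply/andP; split.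
    have [d9|d9] := leqP 9 d.+1; first by rewrite /nonface sd d9.
    have d1P : 3 <= d.+1 < 9 by rewrite d9 ltnW //; case/andP: dP.
    move: Ns sb; rewrite !(nonfaceE _ sd d1P) inE d9 /= => /orP[->//|/andP[->]].
    by [].
  apply/forall_inP => x xs; apply/negP; rewrite (nonfaceE _ (card_setD1 xs sd) dP).
  case/orP => [Lx|/andP[Es]].
    by have := smin x xs; rewrite (nonfaceE _ (card_setD1 xs sd) dP) Lx.
  rewrite GS => tS; have [y ys] := triangle_covers dP sd xs GT Es tS.
  by rewrite (negbTE (smin y ys)).
exists (set_of_tail d [:: false; true; true; true]); first exact: mnf_tail_triple.
rewrite in_setD mem_mnf !negb_and; apply/orP; right; apply/orP; right; apply/orP; right.
set s := set_of_tail _ _; have v15s : v15 \in s by rewrite !inE orbT.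
have sd : #|s| = d.+1 by rewrite card_mk //=; lia.
apply/forall_inPn; exists v15 => //; rewrite negbK (nonfaceE _ (card_setD1 v15s sd) dP).
rewrite eq_head_setD1 // eq_head_mk GT /tail !inE /= !h_low //= orbT //.
Qed.

End ShiftedStates.

(** * No largest and no smallest Betti numbers *)

Section Witnesses.
Set Implicit Arguments.
Unset Strict Implicit.
Unset Printing Implicit Defensive.

Definition run (p : seq ('I_15 * 'I_15)) (G : seq graph) : seq graph :=
  foldl (fun G (ij : 'I_15 * 'I_15) => shift_state (ij.1 - 11) (ij.2 - 11) G) G p.

Lemma comb_shifted_run (p : seq ('I_15 * 'I_15)) :
  all (fun ij : 'I_15 * 'I_15 => 11 <= ij.1 < ij.2) p ->
  stable (run p graphs0) -> comb_shifted (state_complex graphs0) (state_complex (run p graphs0)).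
Proof.
move=> pp st; split; first exact: stable_shifted.
exists p; split; first by apply: sub_all pp => ij /andP[].
rewrite /run; elim: p graphs0 pp {st} => //= -[i j] p IH G /andP[/andP[il ij] pp].
by rewrite (Shift_tail _ il ij); apply: IH.
Qed.

(** Together the three sequences below reach a star and a triangle in every
    degree. *)
Definition moves_to_stars := [:: (v12, v13); (v12, v14); (v12, v15); (v13, v15)].
Definition moves_to_triangle_first := [:: (v14, v15); (v12, v13); (v12, v14)].
Definition moves_to_triangles := [:: (v12, v13); (v13, v14); (v14, v15)].

Lemma run_to_stars : run moves_to_stars graphs0 = [:: star; star; star; star; star; triangle].
Proof. by vm_compute. Qed.
Lemma run_to_triangle_first :
  run moves_to_triangle_first graphs0 = [:: triangle; star; star; star; star; star].
Proof. by vm_compute. Qed.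
Lemma run_to_triangles :
  run moves_to_triangles graphs0 = [:: star; triangle; triangle; triangle; triangle; triangle].
Proof. by vm_compute. Qed.

Lemma comb_shifted_state Dc : comb_shifted (state_complex graphs0) Dc ->
  exists G, [/\ Dc = state_complex G, star_or_triangle G, star \in G & triangle \in G].
Proof.
case=> sh [p [pp DcE]]; have [G GR e] := reachable_foldl reachable_graphs0 pp.
rewrite {}DcE {}e in sh *; exists G; split; first exact: erefl.
all: by have /and3P[] := reachable_stable GR (shifted_stable GR sh).
Qed.

Lemma graph_at_mem G g : star_or_triangle G -> g \in G -> exists2 d, 3 <= d < 9 & graph_at G d = g.
Proof.
case/andP=> _ /eqP s6 gG; exists (index g G + 3); last by rewrite /graph_at addnK nth_index.
by have := gG; rewrite -index_mem s6; lia.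
Qed.

Lemma star_witness d : 3 <= d < 9 ->
  exists2 G, star_or_triangle G /\ graph_at G d = star &
    comb_shifted (state_complex graphs0) (state_complex G).
Proof.
(* The first sequence gives a triangle only in degree 8. *)
move=> dP; have [d8|d8] := eqVneq d 8.
  exists (run moves_to_triangle_first graphs0); last first.
    by apply: comb_shifted_run; rewrite ?run_to_triangle_first.
  by rewrite run_to_triangle_first d8.
exists (run moves_to_stars graphs0); last by apply: comb_shifted_run; rewrite ?run_to_stars.
by rewrite run_to_stars; case: d dP d8 => [|[|[|[|[|[|[|[|[|d]]]]]]]]].
Qed.

Lemma triangle_witness d : 3 <= d < 9 ->
  exists2 G, star_or_triangle G /\ graph_at G d = triangle &
    comb_shifted (state_complex graphs0) (state_complex G).
Proof.
(* The third sequence gives a star only in degree 3. *)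
move=> dP; have [d3|d3] := eqVneq d 3.
  exists (run moves_to_triangle_first graphs0); last first.
    by apply: comb_shifted_run; rewrite ?run_to_triangle_first.
  by rewrite run_to_triangle_first d3.
exists (run moves_to_triangles graphs0); last by apply: comb_shifted_run; rewrite ?run_to_triangles.
by rewrite run_to_triangles; case: d dP d3 => [|[|[|[|[|[|[|[|[|d]]]]]]]]].
Qed.

End Witnesses.

Lemma not_betti_le (K : fieldType) (G G' : seq graph) (d : nat) :
  star_or_triangle G -> star_or_triangle G' -> 3 <= d < 9 ->
  graph_at G d = star -> graph_at G' d = triangle ->
  ~ betti_le (@stanley_reisner K 15 (state_complex G)) (@stanley_reisner K 15 (state_complex G'))
             0 (0 + d.+1).
Proof.
move=> GA GA' dP GS GT le.
have b G'' := betti0_minimal_nonfaces K (@state_complex_down G'') d.+1.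
by have := le _ _ (b G) (b G'); rewrite leqNgt (mnf_star_triangle GA GA' dP GS GT).
Qed.

Theorem theorem4p3 (K : fieldType) (Delta : {set {set 'I_15}})
    (Delta_complex : simplicial_complex Delta)
    (Delta_ideal : forall f : exterior K 15,
       ext_ideal_gen generators f <-> exterior_face_ideal Delta f) :
  (~ exists Dsharp : {set {set 'I_15}}, comb_shifted Delta Dsharp /\
       forall Dc : {set {set 'I_15}}, comb_shifted Delta Dc ->
       forall i j : nat,
         betti_le (@stanley_reisner K 15 Dc) (@stanley_reisner K 15 Dsharp)
                  i (i + j)) /\
  (~ exists Dflat : {set {set 'I_15}}, comb_shifted Delta Dflat /\
       forall Dc : {set {set 'I_15}}, comb_shifted Delta Dc ->
       forall i j : nat,
         betti_le (@stanley_reisner K 15 Dflat) (@stanley_reisner K 15 Dc)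
                  i (i + j)).
Proof.
have -> : Delta = state_complex graphs0.
  have nonfaceP := mem_complex_ideal Delta_complex.2 Delta_ideal.
  apply/setP => s; apply: negb_inj; rewrite [s \in state_complex _]inE negbK.
  apply/idP/idP => [/nonfaceP gs|/nonface_graphs0 gs]; first exact/nonface_graphs0.
  exact/nonfaceP.
split=> -[D [/comb_shifted_state[G [-> GA Gs Gt]] best]].
  have [d dP GT] := graph_at_mem GA Gt.
  have [G' [GA' GS'] /best/(_ 0 d.+1)] := star_witness dP.
  exact: not_betti_le GT.
have [d dP GS] := graph_at_mem GA Gs.
have [G' [GA' GT'] /best/(_ 0 d.+1)] := triangle_witness dP.
exact: not_betti_le GS GT'.
Qed.
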